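(* Let $I\subset R=\mathbb{C}[x,y,z]$ be an artinian ideal generated by $2d+1$ polynomials $l_1^d,\ldots,l_{2d+1}^d$, where the $l_i$ are linear forms on $\mathbb{P}^2$ defining distinct lines and $l_1^d,\ldots,l_{2d+1}^d$ are linearly independent. Let $Z=\{l_1^\vee,\ldots,l_{2d+1}^\vee\}$ be the corresponding set of points in the dual plane $\mathbb{P}^{2\vee}$. Then the following conditions are equivalent: (1) The ideal $I$ fails the SLP at the range $2$ in degree $d-2$. (2) The derivation bundle $\mathcal{D}_0(Z)$ is unstable.
   Context: The ground field is $\mathbb{C}$. With $A=R/I=\bigoplus_jA_j$ ($A_j=0$ for $j<0$), $I$ fails the SLP (Strong Lefschetz Property) at the range $k$ in degree $j$ if for every linear form $L$ the map $\times L^k:A_j\to A_{j+k}$ does not have maximal rank (i.e. is neither injective nor surjective). For a linear form $l$ on $\mathbb{P}^2$, $l^\vee\in\mathbb{P}^{2\vee}$ is the point dual to the line $\{l=0\}$. For a finite set $Z$ of points in $\mathbb{P}^{2\vee}$ dual to distinct lines $l_1,\ldots,l_m$, let $f=\prod_{i=1}^m l_i$; the derivation bundle $\mathcal{D}_0(Z)$ is the rank-two vector bundle on $\mathbb{P}^2$ that is the kernel of the Jacobian map $\mathcal{O}_{\mathbb{P}^2}^3\to\mathcal{O}_{\mathbb{P}^2}(m-1)$ given by the partial derivatives $(\partial_xf,\partial_yf,\partial_zf)$. A rank-two vector bundle $E$ on $\mathbb{P}^2$ is unstable if and only if its splitting $E|_l=\mathcal{O}_l(a)\oplus\mathcal{O}_l(b)$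 on a general line $l$ satisfies $|a-b|\ge2$. *)

(* Defs.v *)
From HB Require Import structures.
From mathcomp Require Import all_boot all_order all_algebra.
From mathcomp Require Import mpoly complex.
From mathcomp Require Import reals.

Set Implicit Arguments.
Unset Strict Implicit.
Unset Printing Implicit Defensive.

Import Order.TTheory GRing.Theory Num.Theory.
Local Open Scope ring_scope.

(* For a model T of the real numbers, T[i] is the field of complex numbers
   and ring3 T is C[x,y,z], with variables 'X_0, 'X_1, 'X_2. *)
Notation ring3 T := {mpoly T[i][3]}.

Section Definitions.
Variable T : realType.
Local Notation C := T[i].
Local Notation R := (ring3 T).

(* The graded piece R_j, for j in Z; it is 0 when j < 0. *)
Definition degree_part (j : int) (g : R) : Prop :=
  match j with
  | Posz n => g \is n.-homog
  | Negz _ => g = 0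
  end.

Definition is_ideal (J : R -> Prop) : Prop :=
  [/\ J 0, forall g h, J g -> J h -> J (g + h) & forall g h, J h -> J (g * h)].

Definition ideal_gen (m : nat) (p : 'I_m -> R) (g : R) : Prop :=
  exists q : 'I_m -> R, g = \sum_i q i * p i.

Definition eqmod (J : R -> Prop) (g h : R) : Prop := J (g - h).

(* R/J is an artinian ring: the descending chain condition on the ideals of
   R/J, seen as the ideals of R containing J. *)
Definition artinian_quotient (J : R -> Prop) : Prop :=
  forall K : nat -> R -> Prop,
    (forall n, is_ideal (K n)) ->
    (forall n g, J g -> K n g) ->
    (forall n g, K n.+1 g -> K n g) ->
    exists N : nat, forall n : nat, (N <= n)%N -> forall g, K n g <-> K N g.

(* With A = R/J: the map u |-> p u : A_j -> A_(j+k), for p of degree k. *)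
Definition mult_injective (J : R -> Prop) (p : R) (j : int) : Prop :=
  forall g h, degree_part j g -> degree_part j h ->
    eqmod J (p * g) (p * h) -> eqmod J g h.

Definition mult_surjective (J : R -> Prop) (p : R) (j : int) (k : nat) : Prop :=
  forall h, degree_part (j + k%:Z) h ->
    exists2 g, degree_part j g & eqmod J (p * g) h.

Definition fails_SLP (J : R -> Prop) (k : nat) (j : int) : Prop :=
  forall L : R, L \is 1.-homog ->
    ~ mult_injective J (L ^+ k) j /\ ~ mult_surjective J (L ^+ k) j k.

Definition same_line (l l' : R) : Prop :=
  forall v : 'I_3 -> C, l.@[v] = 0 <-> l'.@[v] = 0.

(* Points of the dual plane are given by homogeneous coordinates: the point
   c = (c_0 : c_1 : c_2) is dual to the line c_0 x + c_1 y + c_2 z = 0. *)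
Definition dual_point (l : R) : 'rV[C]_3 := \row_k l@_(U_(k)%MM).

Definition dual_form (c : 'rV[C]_3) : R := \sum_k c 0 k *: 'X_k.

Definition arrangement_eq (m : nat) (Z : 'I_m -> 'rV[C]_3) : R :=
  \prod_i dual_form (Z i).

Definition jacobian_map (f : R) (theta : 'rV[R]_3) : R :=
  \sum_k theta 0 k * f^`M(k).

(* A sheaf E on P^2 that is the kernel of a map O^n -> O(e) is given by its
   twisted global sections: sheaf j = H^0(P^2, E(j)), a subspace of (R_j)^n,
   j in Z; together they form the graded R-module M of E. *)
Definition graded_sections (n : nat) := int -> 'rV[R]_n -> Prop.

Definition derivation_bundle (m : nat) (Z : 'I_m -> 'rV[C]_3) :
    graded_sections 3 :=
  fun j theta => (forall k, degree_part j (theta 0 k)) /\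
    jacobian_map (arrangement_eq Z) theta = 0.

(* E|_l = O_l(a) (+) O_l(b), l being the line l = 0. With S = R/(l), the sheaf
   E|_l is associated with the graded S-module M/lM and O_l(a) (+) O_l(b) with
   S(a) (+) S(b); by Serre's theorem these sheaves are isomorphic if and only
   if the two modules are isomorphic in all large degrees.
   Such an isomorphism is represented by psi, taking values in R x R
   considered modulo l; only its values on the M_j with n0 <= j matter. *)
Definition splits_on_line (n : nat) (M : graded_sections n) (l : R)
    (a b : int) : Prop :=
  let S_eq := eqmod (ideal_gen (fun _ : 'I_1 => l)) in
  let S2_eq (u v : R * R) := S_eq u.1 v.1 /\ S_eq u.2 v.2 in
  exists (n0 : int) (psi : 'rV[R]_n -> R * R), forall j : int, n0 <= j ->
    [/\ forall theta, M j theta ->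
          degree_part (j + a) (psi theta).1 /\
          degree_part (j + b) (psi theta).2,
        forall theta eta, M j theta -> M j eta ->
          S2_eq (psi (theta + eta))
                ((psi theta).1 + (psi eta).1, (psi theta).2 + (psi eta).2),
        forall (k : nat) (g : R) theta, g \is k.-homog -> M j theta ->
          S2_eq (psi (g *: theta)) (g * (psi theta).1, g * (psi theta).2),
        forall theta, M j theta ->
          (S2_eq (psi theta) (0, 0) <->
           exists2 eta, M (j - 1) eta & theta = l *: eta)
      & forall u v : R, degree_part (j + a) u -> degree_part (j + b) v ->
          exists2 theta, M j theta & S2_eq (psi theta) (u, v)].

(* P holds for the lines in a nonempty Zariski open subset of the dual plane;
   the basic open sets {F <> 0} suffice. *)
Definition for_general_line (P : R -> Prop) : Prop :=
  exists (e : nat) (F : R), [/\ F != 0, F \is e.-homog &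
    forall c : 'rV[C]_3, c != 0 -> F.@[fun k => c 0 k] != 0 ->
      P (dual_form c)].

(* Instability of a rank-two vector bundle in terms of its splitting
   O_l(a) (+) O_l(b) on a general line. *)
Definition unstable (n : nat) (M : graded_sections n) : Prop :=
  for_general_line (fun l =>
    exists a b : int, splits_on_line M l a b /\ (2 <= `|a - b|)).

End Definitions.

(* Main.v *)
Require Import Defs.
From HB Require Import structures.
From mathcomp Require Import all_boot all_order all_algebra.
From mathcomp Require Import mpoly complex.
From mathcomp Require Import boolp reals.
From mathcomp Require Import zify ring.

Import Order.TTheory GRing.Theory Num.Theory.
Local Open Scope ring_scope.

Set Implicit Arguments.
Unset Strict Implicit.
Unset Printing Implicit Defensive.

(* Fix a general line c = 0, let a, b be points spanning it and e a point off
   it, and dehomogenize forms on the line to polynomials in X by evaluation at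
   X a + b.  Put lam_i = l_i(a), mu_i = l_i(e), and let t_i be the parameter of
   the intersection with l_i = 0.  Modulo the Euler derivation, a derivation
   restricted to the line is a pair (delta, gamma) of polynomials with
     lam_i delta(t_i) + mu_i gamma(t_i) = 0   for all i.
   These pairs form a lattice of rank two and determinant prod_i (X - t_i),
   with a homogeneous basis of degrees e0 <= d and 2d - e0, so the bundle splits
   on the line as O(-e0) + O(e0 - 2d), and it is unstable there if and only if
   the lattice has a nonzero element of degree d - 1: 2d + 1 unknown
   coefficients subject to 2d + 1 conditions.

   The transposed linear system, in x_1, ..., x_(2d+1), says that
   sum_i x_i l_i^d vanishes to order two along c = 0, i.e. equals c^2 g, i.e.
   that multiplication by c^2 is not injective on A_(d-2); as the system is
   square this also means that it is not surjective.  Its determinant is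
   polynomial in c, so vanishing for general c is vanishing for all c. *)

(** * Multivariate polynomials *)

(** The two degrees add up to 2d, so their difference 2(d - e0) is even: the restriction is either
    balanced or has gap at least 2, and the threshold is exactly e0 < d. Two mismatches with the
    definitions shape the proof. The graded module of the bundle modulo the line embeds in the
    lattice but is shown to fill it only in high degrees, so lattice elements are lifted to
    derivations asymptotically. And [unstable] supplies an arbitrary splitting on each general line,
    whose twists must be compared with e0; this takes a form of uniqueness of the splitting type,
    proved by comparing degrees of determinants. Small d is covered as follows: independence of the
    powers turns a nonzero kernel vector into a nonzero g and excludes d = 1, where c^2 g has no
    room; for d = 0 the lattice has no nonzero element of degree -1. *)

Section MPolyComplements.
Variable K : numFieldType.

Lemma exists_nonroot (p : {poly K}) : p != 0 -> exists x, p.[x] != 0.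
Proof.
move=> p0; pose s := [seq i%:R : K | i <- iota 0 (size p)].
have us : uniq s.
  rewrite map_inj_uniq ?iota_uniq // => i j /eqP; by rewrite eqr_nat => /eqP.
case: (boolP (all (root p) s)) => [rs|/allPn [x _]].
  by have := max_poly_roots p0 rs us; rewrite size_map size_iota ltnn.
by rewrite rootE => px; exists x.
Qed.

Lemma base_digits_inj n N (f g : 'I_n -> nat) :
  (forall i, f i < N)%N -> (forall i, g i < N)%N ->
  (\sum_i f i * N ^ i = \sum_i g i * N ^ i)%N -> f =1 g.
Proof.
elim: n f g => [|n IH] f g fN gN; first by move=> _ [].
have shift (h : 'I_n.+1 -> nat) :
    (\sum_i h i * N ^ i = (\sum_(i < n) h (lift ord0 i) * N ^ i) * N + h ord0)%N.
  rewrite big_ord_recl muln1 addnC big_distrl /=; congr addn.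
  by apply: eq_bigr => i _; rewrite /bump add1n expnSr mulnA.
rewrite !shift => E.
have E0 : f ord0 = g ord0.
  by have := congr1 (modn^~ N) E; rewrite !modnMDl !modn_small.
have N0 : (0 < N)%N by apply: leq_ltn_trans (fN ord0).
have E1 i : f (lift ord0 i) = g (lift ord0 i).
  apply: (IH (fun i => f (lift ord0 i)) (fun i => g (lift ord0 i))) => //.
  by move: E; rewrite E0 => /addIn /eqP; rewrite eqn_pmul2r // => /eqP.
by move=> i; case: (unliftP ord0 i) => [j|] ->.
Qed.

(* Kronecker's substitution X_i := X^(N^i) with N larger than all exponents
   separates the monomials. *)
Lemma exists_meval_neq0 n (P : {mpoly K[n]}) :
  P != 0 -> exists v : 'I_n -> K, P.@[v] != 0.
Proof.
move=> P0; pose N := msize P.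
pose kap (m : 'X_{1..n}) := (\sum_i m i * N ^ i)%N.
pose p : {poly K} := \sum_(m <- msupp P) P@_m *: 'X^(kap m).
have pE x : p.[x] = P.@[fun i : 'I_n => x ^+ (N ^ i)].
  rewrite mevalE horner_sum; apply: eq_bigr => m _.
  rewrite hornerZ hornerXn /kap expr_sum; congr (_ * _).
  by apply: eq_bigr => i _; rewrite -exprM mulnC.
suff /exists_nonroot [x] : p != 0 by rewrite pE => px; exists (fun i => x ^+ (N ^ i)).
have ltN m : m \in msupp P -> forall i, (m i < N)%N.
  move=> /msize_mdeg_lt h i; apply: leq_ltn_trans h.
  by rewrite mdegE (bigD1 i) //= leq_addr.
have m0P := mlead_supp P0; set m0 := mlead P in m0P.
have : p`_(kap m0) = P@_m0.
  rewrite coef_sum (bigD1_seq m0) //= coefZ coefXn eqxx mulr1.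
  rewrite big_seq_cond big1 ?addr0 // => m /andP [mP nm].
  rewrite coefZ coefXn; case: eqP => [/esym E|]; last by rewrite mulr0.
  case/eqP: nm; apply/mnmP; apply: base_digits_inj E; exact: ltN.
by move=> E; apply: contraTneq m0P => p0; rewrite mcoeff_msupp -E p0 coef0 eqxx.
Qed.

(** Reduces a linear statement about forms to multiplication by one variable; serves [size_restr]
    and [homz_mod]. *)
Lemma dhomog_ind3 (Q : nat -> {mpoly K[3]} -> Prop) :
  (forall n, Q n 0) ->
  (forall n c g h, Q n g -> Q n h -> Q n (c *: g + h)) ->
  Q 0 1 -> (forall n k g, g \is n.-homog -> Q n g -> Q n.+1 ('X_k * g)) ->
  forall n g, g \is n.-homog -> Q n g.
Proof.
move=> Q0 QD Q1 QX.
have Qm n (m : 'X_{1..3}) : mdeg m = n -> Q n 'X_[m].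
  elim: n m => [|n IH] m dm.
    by move/eqP: dm; rewrite mdeg_eq0 => /eqP ->; rewrite mpolyX0.
  have [k mk] : exists k, m k != 0.
    apply/existsP; apply: contra_eqT dm => /existsPn h.
    by rewrite mdegE big1 // => i _; apply/eqP/negbNE/h.
  have mE : m = (U_(k) + (m - U_(k)))%MM.
    by rewrite addmC submK // lep1mP.
  have dm' : mdeg (m - U_(k))%MM = n.
    by move: dm; rewrite {1}mE mdegD mdeg1 => -[].
  by rewrite mE mpolyXD; apply: QX; [by rewrite dhomogX; apply/eqP|exact: IH].
move=> n g /dhomogP hg; rewrite [g]mpolyE big_seq.
elim/big_rec: _ => [|m h mg Qh]; first exact: Q0.
by apply: QD => //; apply: Qm; exact: hg.
Qed.

Section Leibniz.
Variables (n : nat) (k : 'I_n).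
Implicit Type g : {mpoly K[n]}.

Lemma mderiv_exp g d : (g ^+ d)^`M(k) = d%:R *: (g ^+ d.-1 * g^`M(k)).
Proof.
elim: d => [|d IH]; first by rewrite expr0 -mpolyC1 mderivC scale0r.
rewrite exprS mderivM IH; case: d {IH} => [|d] /=.
  by rewrite expr0 scale0r mulr0 addr0 mulr1 mul1r scale1r.
by rewrite -scalerAr mulrA -exprS mulrC -[X in X + _]scale1r -scalerDl nat1r.
Qed.

Lemma mderiv_prod (I : eqType) (r : seq I) (F : I -> {mpoly K[n]}) : uniq r ->
  (\prod_(i <- r) F i)^`M(k) =
  \sum_(i <- r) (F i)^`M(k) * \prod_(j <- r | j != i) F j.
Proof.
elim: r => [|i r IH] /=; first by rewrite !big_nil -mpolyC1 mderivC.
move=> /andP [ir ur]; rewrite !big_cons mderivM IH // eqxx /=.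
congr (_ * _ + _).
  rewrite [LHS]big_seq [RHS]big_seq_cond; apply: eq_bigl => j.
  by case: (boolP (j \in r)) => //= jr; apply/esym; apply: contraNneq ir => <-.
rewrite mulr_sumr; apply: eq_big_seq => j jr.
rewrite big_cons ifT; first by rewrite mulrCA.
by apply: contraNneq ir => ->.
Qed.

End Leibniz.

(** Membership in [ideal_gen] comes with inhomogeneous coefficients; this lemma and the next project
    such a combination to a single degree. *)
Lemma pihomog_mul n (p q : {mpoly K[n]}) e d : p \is e.-homog ->
  pihomog mdeg (d + e) (q * p) = pihomog mdeg d q * p.
Proof.
move=> hp; pose N := maxn (msize q) d.+1.
have dN : (d < N)%N by rewrite leq_max ltnSn orbT.
rewrite {1}(pihomog_partitionE (mf := mdeg) (k := N) (p := q)); last first.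
  exact: leq_maxl.
rewrite mulr_suml raddf_sum (bigD1 (Ordinal dN)) //= big1 ?addr0.
  by rewrite pihomog_dE //; apply: dhomogM => //; apply: pihomogP.
move=> i ne /=; apply: (@pihomog_ne0 _ _ _ (i + e)%N).
  by rewrite eqn_add2r.
by apply: dhomogM => //; apply: pihomogP.
Qed.

Lemma pihomog_mul_lt n (p q : {mpoly K[n]}) e d : p \is e.-homog -> (d < e)%N ->
  pihomog mdeg d (q * p) = 0.
Proof.
move=> hp de.
rewrite (pihomog_partitionE (mf := mdeg) (k := msize q) (p := q)) //.
rewrite mulr_suml raddf_sum big1 // => i _ /=.
apply: (@pihomog_ne0 _ _ _ (i + e)%N).
  by rewrite gtn_eqF // (leq_trans de) // leq_addl.
by apply: dhomogM => //; apply: pihomogP.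
Qed.

Lemma dhomog0_const n (g : {mpoly K[n]}) : g \is 0.-homog -> g = (g@_0)%:MP.
Proof.
move=> hg; apply/mpolyP => m; rewrite mcoeffC.
have [->|m0] := eqVneq m 0%MM; first by rewrite mulr1.
by rewrite mulr0 (dhomog_nemf_coeff hg) //= mdeg_eq0.
Qed.

End MPolyComplements.

(** * The lattice of restricted derivations *)

(* lia compares atoms syntactically, whereas occurrences of size p may differ
   in the structure at which the coefficient type is inferred. *)
Definition poly_size (R : nzSemiRingType) (p : {poly R}) := size p.
Ltac plia :=
  repeat match goal with
  | H : context [@size ?T (@polyseq ?R ?p)] |- _ =>
      change (@size T (@polyseq R p)) with (poly_size p) in H
  | |- context [@size ?T (@polyseq ?R ?p)] =>
      change (@size T (@polyseq R p)) with (poly_size p)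
  end; lia.

Section Lattice.
Variables (K : fieldType) (d : nat).
Local Notation m := (d.+1 + d)%N.
Variables lam mu t : 'I_m -> K.
Hypothesis lam_neq0 : forall i, lam i != 0.
Hypothesis t_inj : injective t.
Local Notation V := ({poly K} * {poly K})%type.
Implicit Types (p q : {poly K}) (x y w v : V) (n : nat).

Definition pscale p x : V := (p * x.1, p * x.2).
Definition pdet x y : {poly K} := x.1 * y.2 - x.2 * y.1.

Definition in_lattice x : Prop :=
  forall i, lam i * x.1.[t i] + mu i * x.2.[t i] = 0.

(* These are the elements of degree n - 1 of the graded module of the
   restricted bundle, dehomogenized. *)
Definition lattice_le n x : Prop :=
  [/\ in_lattice x, (size x.1 <= n.+1)%N & (size x.2 <= n)%N].

Definition node_poly : {poly K} := \prod_i ('X - (t i)%:P).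

Lemma size_node_poly : size node_poly = m.+1.
Proof. by rewrite size_prod_XsubC [index_enum _]unlock -enumT size_enum_ord. Qed.

Lemma node_poly_neq0 : node_poly != 0.
Proof. by rewrite -size_poly_eq0 size_node_poly. Qed.

Lemma node_poly_dvdp p : (forall i, p.[t i] = 0) -> node_poly %| p.
Proof.
move=> pt; have -> : node_poly = \prod_(z <- [seq t i | i <- enum 'I_m]) ('X - z%:P).
  by rewrite big_map big_enum.
apply: uniq_roots_dvdp.
  by apply/allP => _ /mapP [i _ ->]; apply/eqP.
by rewrite uniq_rootsE map_inj_uniq ?enum_uniq.
Qed.

Lemma in_latticeD x y : in_lattice x -> in_lattice y -> in_lattice (x + y).
Proof.
move=> hx hy i; rewrite /= !hornerD !mulrDr addrACA hx hy addr0 //.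
Qed.

Lemma in_lattice_scale p x : in_lattice x -> in_lattice (pscale p x).
Proof.
move=> hx i; rewrite /= !hornerM mulrCA [X in _ + X]mulrCA -mulrDr hx mulr0 //.
Qed.

Lemma in_lattice_comb p x y : in_lattice x -> in_lattice y ->
  in_lattice (y - pscale p x).
Proof.
move=> hx hy; have -> : y - pscale p x = y + pscale (- p) x.
  by rewrite /pscale !mulNr.
by apply: in_latticeD => //; apply: in_lattice_scale.
Qed.

(** At [t i] both values are orthogonal to the nonzero vector ([lam i], [mu i]), so the determinant
    vanishes at every node. *)
Lemma node_poly_dvd_pdet x y :
  in_lattice x -> in_lattice y -> node_poly %| pdet x y.
Proof.
move=> hx hy; apply: node_poly_dvdp => i; apply: (mulfI (lam_neq0 i)).
rewrite /pdet hornerD hornerN !hornerM mulr0.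
have E (a b c e l u : K) : l * (a * b - c * e) =
  (l * a + u * c) * b - (l * e + u * b) * c by ring.
by rewrite (E _ _ _ _ _ (mu i)) (hx i) (hy i) !mul0r subr0.
Qed.

Lemma lattice_le_comb n p x y : lattice_le n y -> in_lattice x ->
  (size (p * x.1)%R <= n.+1)%N -> (size (p * x.2)%R <= n)%N ->
  lattice_le n (y - pscale p x).
Proof.
move=> [hy y1 y2] hx s1 s2; split; first exact: in_lattice_comb.
  by rewrite (leq_trans (size_polyD _ _)) // size_polyN geq_max y1.
by rewrite (leq_trans (size_polyD _ _)) // size_polyN geq_max y2.
Qed.

Lemma lattice_le0 x : lattice_le 0 x -> x = 0.
Proof.
case: x => a b [hx /= sa]; rewrite leqn0 size_poly_eq0 => /eqP b0.
have [c ac] : exists c, a = c%:P by exists a`_0; apply: size1_polyC.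
have := hx (lshift d ord0); rewrite /= b0 ac horner0 hornerC mulr0 addr0.
by move/eqP; rewrite mulf_eq0 (negbTE (lam_neq0 _)) => /eqP ->.
Qed.

(* Being in the lattice amounts to m linear conditions on the coefficients. *)
Lemma lattice_exists n1 n2 : (m < n1 + n2)%N ->
  exists x, [/\ x != 0, in_lattice x, (size x.1 <= n1)%N & (size x.2 <= n2)%N].
Proof.
move=> lt_m; pose A : 'M[K]_(n1 + n2, m) := 
  col_mx (\matrix_(k, i) (lam i * t i ^+ k)) (\matrix_(k, i) (mu i * t i ^+ k)).
have : kermx A != 0.
  rewrite kermx_eq0; apply/negP => /eqP fA.
  by have := rank_leq_col A; rewrite fA leqNgt lt_m.
case/rowV0Pn => u /sub_kermxP uA u0.
have hE n (f : 'I_m -> K) i (a : 'rV[K]_n) :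
    (a *m (\matrix_(k, i) (f i * t i ^+ k))) 0 i = f i * (rVpoly a).[t i].
  rewrite !mxE (horner_coef_wide _ (size_poly _ _)) big_distrr /=.
  by apply: eq_bigr => k _; rewrite !mxE coef_rVpoly_ord mulrCA.
exists (rVpoly (lsubmx u), rVpoly (rsubmx u)); split; rewrite ?size_poly //.
  apply: contra u0 => /eqP [h1 h2]; rewrite -[u]hsubmxK.
  rewrite -[lsubmx u]rVpolyK -[rsubmx u]rVpolyK.
  by rewrite (_ : rVpoly _ = 0) // (_ : rVpoly (rsubmx u) = 0) // !linear0 row_mx0.
move=> i /=; move/rowP/(_ i): uA; rewrite -[u]hsubmxK mul_row_col mxE !hE mxE.
by rewrite hsubmxK.
Qed.

(** Being a basis is encoded by the determinant, which is as small as [node_poly_dvd_pdet] allows;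
    Cramer's rule then gives coordinates. In terms of degrees, [w] has n0 - 1 and [v] has m - n0. *)
Definition primitive_basis n0 w v : Prop :=
  [/\ lattice_le n0 w,
      forall n x, (n < n0)%N -> lattice_le n x -> x = 0,
      lattice_le (m.+1 - n0) v
    & exists2 c, c != 0 & pdet v w = c *: node_poly].

Lemma size_mul_le p q a b : (size p <= a)%N -> (size q <= b)%N ->
  (size (p * q)%R <= (a + b).-1)%N.
Proof. by move=> pa qb; rewrite (leq_trans (size_polyMleq _ _)) //; plia. Qed.

Lemma size_pdet_le n1 n2 x y : lattice_le n1 x -> lattice_le n2 y ->
  (size (pdet x y) <= n1 + n2)%N.
Proof.
move=> [_ x1 x2] [_ y1 y2]; rewrite (leq_trans (size_polyD _ _)) // size_polyN.
rewrite geq_max (leq_trans (size_mul_le x1 y2)) ?(leq_trans (size_mul_le x2 y1)) //; plia.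
Qed.

(** * Nonzero lattice elements of minimal degree *)

Section Minimal.
Variables (n0 : nat) (w : V).
Hypotheses (w_le : lattice_le n0 w) (w_neq0 : w != 0).
Hypothesis w_min : forall n x, (n < n0)%N -> lattice_le n x -> x = 0.

Lemma minimal_gt0 : (0 < n0)%N.
Proof.
case: posnP => // n00; move: w_le; rewrite n00 => /lattice_le0 /eqP.
by rewrite (negbTE w_neq0).
Qed.

Lemma minimal_size : size w.1 = n0.+1 \/ size w.2 = n0.
Proof.
have n_gt0 := minimal_gt0; have [hw w1 w2] := w_le.
case: (eqVneq (size w.1) n0.+1) => [|n1]; first by left.
case: (eqVneq (size w.2) n0) => [|n2]; first by right.
have /w_min : (n0.-1 < n0)%N by plia.
move=> /(_ w) E; case/eqP: w_neq0; apply: E; split=> //; plia.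
Qed.

Lemma minimal_mul_size n p : lattice_le n (pscale p w) -> (size p <= n.+1 - n0)%N.
Proof.
move=> [_ /= s1 s2]; have [->|p0] := eqVneq p 0; first by rewrite size_poly0.
have sp : (0 < size p)%N by rewrite size_poly_gt0.
have n_gt0 := minimal_gt0.
case: minimal_size => sw.
  have w0 : w.1 != 0 by rewrite -size_poly_eq0 sw.
  by move: s1; rewrite size_mul // sw; plia.
have w0 : w.2 != 0 by rewrite -size_poly_eq0 sw; plia.
by move: s2; rewrite size_mul // sw; plia.
Qed.

Lemma pdet_pscale x p y : pdet (x - pscale p y) y = pdet x y.
Proof. by rewrite /pdet /=; ring. Qed.

(* Euclidean division by the component of w of top degree; the remainder is
   proportional to w but smaller, hence 0 by minimality. *)
Lemma minimal_primitive y : in_lattice y -> pdet y w = 0 ->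
  exists p, y = pscale p w.
Proof.
move=> hy; have n_gt0 := minimal_gt0; have [hw w1 w2] := w_le.
(* Proportionality transfers the drop in degree from one component to the other, so [z] lies in
   [lattice_le n0.-1]. *)
have small z : in_lattice z -> z.1 * w.2 = z.2 * w.1 ->
    (w.1 != 0 /\ (size z.1 < size w.1)%N /\ size w.1 = n0.+1)
    \/ (w.2 != 0 /\ (size z.2 < size w.2)%N /\ size w.2 = n0) -> z = 0.
  move=> hz E h; apply: (@w_min n0.-1); first plia.
  have E' := congr1 (fun p : {poly K} => size p) E.
  case: h => -[w0 [sz sw]].
    have [z20|z20] := eqVneq z.2 0.
      by split; rewrite ?z20 ?size_poly0 //; plia.
    have w20 : w.2 != 0.
      apply: contra_neq z20 => w20; move/eqP: E.
      by rewrite w20 mulr0 eq_sym mulf_eq0 (negbTE w0) orbF => /eqP.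
    have z10 : z.1 != 0.
      apply: contra_neq z20 => z10; move/eqP: E.
      by rewrite z10 mul0r eq_sym mulf_eq0 (negbTE w0) orbF => /eqP.
    move: E'; rewrite !size_mul //; move: z10 z20 w20; rewrite -!size_poly_gt0.
    by split=> //; plia.
  have [z10|z10] := eqVneq z.1 0.
    by split; rewrite ?z10 ?size_poly0 //; plia.
  have w10 : w.1 != 0.
    apply: contra_neq z10 => w10; move/eqP: E.
    by rewrite w10 mulr0 mulf_eq0 (negbTE w0) orbF => /eqP.
  have z20 : z.2 != 0.
    apply: contra_neq z10 => z20; move/eqP: E.
    by rewrite z20 mul0r mulf_eq0 (negbTE w0) orbF => /eqP.
  move: E'; rewrite !size_mul //; move: z10 z20 w10; rewrite -!size_poly_gt0.
  by split=> //; plia.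
move=> dy; have dp p : (y - pscale p w).1 * w.2 = (y - pscale p w).2 * w.1.
  by apply/eqP; rewrite -subr_eq0; apply/eqP; rewrite -dy -(pdet_pscale y p).
case: minimal_size => sw.
  have w0 : w.1 != 0 by rewrite -size_poly_eq0 sw.
  exists (y.1 %/ w.1); apply/eqP; rewrite -subr_eq0; apply/eqP/small => //.
    exact: in_lattice_comb.
  left; split=> //; split=> //=.
  by rewrite {1}(divp_eq y.1 w.1) addrC addKr ltn_modp.
have w0 : w.2 != 0 by rewrite -size_poly_eq0 sw; plia.
exists (y.2 %/ w.2); apply/eqP; rewrite -subr_eq0; apply/eqP/small => //.
  exact: in_lattice_comb.
right; split=> //; split=> //=.
by rewrite {1}(divp_eq y.2 w.2) addrC addKr ltn_modp.
Qed.

End Minimal.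

(* The complement v is found among the elements whose component in the
   position of top degree of w has smaller degree than that of w. *)
Lemma exists_primitive_basis : exists n0 w v,
  [/\ (n0 <= d.+1)%N, w != 0 & primitive_basis n0 w v].
Proof.
pose P n := `[< exists2 w, w != 0 & lattice_le n w >].
(* There are 2d + 3 unknown coefficients against 2d + 1 conditions, whence n0 <= d + 1. *)
have Pd : P d.+1.
  apply/asboolP; have /lattice_exists [w [w0 hw w1 w2]] : (m < d.+2 + d.+1)%N by plia.
  by exists w.
have exP : exists n, P n by exists d.+1.
case: (ex_minnP exP) => n0 /asboolP [w w0 hw] min.
have w_min n x : (n < n0)%N -> lattice_le n x -> x = 0.
  move=> lt_n hx; apply/eqP; apply: contraLR lt_n => x0; rewrite -leqNgt.
  by apply: min; apply/asboolP; exists x.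
have n0_gt0 := minimal_gt0 hw w0; have n0d := min _ Pd.
suff [v [v0 hv dv]] : exists v, [/\ v != 0, lattice_le (m.+1 - n0) v & pdet v w != 0].
  exists n0, w, v; split=> //; split=> //.
  have /dvdpP [h hE] : node_poly %| pdet v w.
    by apply: node_poly_dvd_pdet; [case: hv|case: hw].
  have h0 : h != 0 by apply: contraNneq dv => h0; rewrite hE h0 mul0r.
  (* The bounds n0 and m + 1 - n0 add up to m + 1, the size of [node_poly], so the cofactor is
     constant. *)
  have : (size h <= 1)%N.
    have := size_pdet_le hv hw; rewrite hE size_mul // ?node_poly_neq0 //.
    by rewrite size_node_poly; plia.
  move/size1_polyC => hC; exists h`_0; first by rewrite -polyC_eq0 -hC.
  by rewrite hE {1}hC mul_polyC.
case: (minimal_size hw w0 w_min) => sw.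
  have w10 : w.1 != 0 by rewrite -size_poly_eq0 sw.
  (* With the bound on the first component lowered to [n0] there remain m + 1 unknowns, still one
     more than the conditions, while a nonzero multiple of [w] exceeds the lowered bound. *)
  have /lattice_exists [v [v0 hv v1 v2]] : (m < n0 + (m.+1 - n0))%N by plia.
  exists v; split=> //; first by split=> //; plia.
  apply: contra v0 => /eqP /(minimal_primitive hw w0 w_min hv) [p vE].
  have [p0|p0] := eqVneq p 0; first by rewrite vE p0 /pscale !mul0r.
  move: v1; rewrite vE /= size_mul // sw; move: p0; rewrite -size_poly_gt0; plia.
have w20 : w.2 != 0 by rewrite -size_poly_eq0 sw; plia.
have /lattice_exists [v [v0 hv v1 v2]] : (m < (m.+2 - n0) + n0.-1)%N by plia.
exists v; split=> //; first by split=> //; plia.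
apply: contra v0 => /eqP /(minimal_primitive hw w0 w_min hv) [p vE].
have [p0|p0] := eqVneq p 0; first by rewrite vE p0 /pscale !mul0r.
move: v2; rewrite vE /= size_mul // sw; move: p0; rewrite -size_poly_gt0; plia.
Qed.

(** Cramer's rule: the coefficient of [v] is the polynomial quotient of [pdet y w] by [pdet v w].
    After subtracting that multiple of [v], the rest has zero determinant with [w], so it is a
    multiple of [w]. *)
Lemma primitive_basis_decomp n0 w v n y : (n0 <= d.+1)%N -> w != 0 ->
  primitive_basis n0 w v -> lattice_le n y ->
  exists p q, [/\ y = pscale p w + pscale q v,
    (size p <= n.+1 - n0)%N & (size q <= n + n0 - m)%N].
Proof.
move=> n0d w0 [hw w_min hv [c c0 dv]] hy.
have /dvdpP [h hE] : node_poly %| pdet y w.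
  by apply: node_poly_dvd_pdet; [case: hy|case: hw].
have sh : (size h <= n + n0 - m)%N.
  have [->|h0] := eqVneq h 0; first by rewrite size_poly0.
  have := size_pdet_le hy hw; rewrite hE size_mul ?node_poly_neq0 //.
  rewrite size_node_poly; plia.
pose q := c^-1 *: h; have sq : (size q <= n + n0 - m)%N.
  by rewrite size_scale ?invr_eq0.
have yq : lattice_le n (y - pscale q v).
  have [_ v1 v2] := hv; have n_gt0 := minimal_gt0 hw w0.
  have [q0|q0] := eqVneq q 0.
    apply: lattice_le_comb => //; rewrite ?q0 ?mul0r ?size_poly0 //; by case: hv.
  have := q0; rewrite -size_poly_gt0 => q_gt0.
  apply: lattice_le_comb => //; first by case: hv.
    by rewrite (leq_trans (size_mul_le sq v1)) //; plia.
  by rewrite (leq_trans (size_mul_le sq v2)) //; plia.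
have [||p pE] := @minimal_primitive n0 w hw w0 w_min (y - pscale q v).
- by case: yq.
- have -> : pdet (y - pscale q v) w = pdet y w - q * pdet v w.
    by rewrite /pdet /=; ring.
  by rewrite hE dv -mul_polyC mulrCA mulrA mul_polyC scalerA divff // scale1r subrr.
exists p, q; split=> //; first by rewrite -pE subrK.
by apply: (minimal_mul_size hw w0 w_min); rewrite -pE.
Qed.

Section Coordinates.
Variables (n0 : nat) (w v : V).
Hypotheses (n0d : (n0 <= d.+1)%N) (w_neq0 : w != 0).
Hypothesis wv : primitive_basis n0 w v.

(** Cramer's rule written with polynomial division, so that the coordinates are total functions, as
    the map in [splits_on_line] must be. *)
Definition coord1 x : {poly K} := - (pdet x v %/ pdet v w).
Definition coord2 x : {poly K} := pdet x w %/ pdet v w.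

Lemma pdet_basis_neq0 : pdet v w != 0.
Proof.
by have [_ _ _ [l l0 ->]] := wv; rewrite scaler_eq0 negb_or l0 node_poly_neq0.
Qed.

Lemma size_pdet_basis : size (pdet v w) = m.+1.
Proof. by have [_ _ _ [l l0 ->]] := wv; rewrite size_scale // size_node_poly. Qed.

Lemma coord_uniq p q : coord1 (pscale p w + pscale q v) = p /\
  coord2 (pscale p w + pscale q v) = q.
Proof.
rewrite /coord1 /coord2; split.
  have -> : pdet (pscale p w + pscale q v) v = (- p) * pdet v w.
    by rewrite /pdet /=; ring.
  by rewrite mulpK ?pdet_basis_neq0 // opprK.
have -> : pdet (pscale p w + pscale q v) w = q * pdet v w.
  by rewrite /pdet /=; ring.
by rewrite mulpK ?pdet_basis_neq0.
Qed.

Lemma coord_lattice n x : lattice_le n x ->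
  [/\ x = pscale (coord1 x) w + pscale (coord2 x) v,
      (size (coord1 x) <= n.+1 - n0)%N & (size (coord2 x) <= n + n0 - m)%N].
Proof.
move=> hx; have [p [q [xE sp sq]]] := primitive_basis_decomp n0d w_neq0 wv hx.
by have [E1 E2] := coord_uniq p q; rewrite xE E1 E2.
Qed.

Lemma coordD n x y : lattice_le n x -> lattice_le n y ->
  coord1 (x + y) = coord1 x + coord1 y /\ coord2 (x + y) = coord2 x + coord2 y.
Proof.
move=> /coord_lattice [xE _ _] /coord_lattice [yE _ _].
have := coord_uniq (coord1 x + coord1 y) (coord2 x + coord2 y).
suff -> : pscale (coord1 x + coord1 y) w + pscale (coord2 x + coord2 y) v = x + y by [].
by rewrite [in RHS]xE [in RHS]yE /pscale; congr pair => /=; ring.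
Qed.

Lemma coordZ n p x : lattice_le n x ->
  coord1 (pscale p x) = p * coord1 x /\ coord2 (pscale p x) = p * coord2 x.
Proof.
move=> /coord_lattice [xE _ _].
have := coord_uniq (p * coord1 x) (p * coord2 x).
suff -> : pscale (p * coord1 x) w + pscale (p * coord2 x) v = pscale p x by [].
by rewrite [in RHS]xE /pscale; congr pair => /=; ring.
Qed.

Lemma coord0 : coord1 0 = 0 /\ coord2 0 = 0.
Proof. by rewrite /coord1 /coord2 /pdet !mul0r subrr !div0p oppr0. Qed.

End Coordinates.

End Lattice.

(** * Restriction to a line *)

Section Vectors.
Variable K : fieldType.
Implicit Types x y z : 'rV[K]_3.

Lemma forall_ord3 (P : 'I_3 -> Prop) : P 0 -> P 1 -> P 2%:R -> forall k, P k.
Proof.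
move=> P0 P1 P2 [[|[|[|]]] h] //; [move: P0|move: P1|move: P2];
by congr P; apply: val_inj.
Qed.

Lemma sum_ord3 (M : nmodType) (F : 'I_3 -> M) :
  \sum_k F k = F 0 + F 1 + F 2%:R.
Proof.
rewrite !big_ord_recl big_ord0 addr0 addrA.
by congr (F _ + F _ + F _); apply: val_inj.
Qed.

Definition dot x y : K := \sum_k x 0 k * y 0 k.

Definition cross x y : 'rV[K]_3 :=
  \row_k (if k == 0 then x 0 1 * y 0 2%:R - x 0 2%:R * y 0 1
          else if k == 1 then x 0 2%:R * y 0 0 - x 0 0 * y 0 2%:R
          else x 0 0 * y 0 1 - x 0 1 * y 0 0).

Lemma dotE x y : dot x y = x 0 0 * y 0 0 + x 0 1 * y 0 1 + x 0 2%:R * y 0 2%:R.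
Proof. exact: sum_ord3. Qed.

Lemma crossE0 x y : cross x y 0 0 = x 0 1 * y 0 2%:R - x 0 2%:R * y 0 1.
Proof. by rewrite mxE. Qed.
Lemma crossE1 x y : cross x y 0 1 = x 0 2%:R * y 0 0 - x 0 0 * y 0 2%:R.
Proof. by rewrite mxE. Qed.
Lemma crossE2 x y : cross x y 0 2%:R = x 0 0 * y 0 1 - x 0 1 * y 0 0.
Proof. by rewrite mxE. Qed.
Definition crossE := (crossE0, crossE1, crossE2).

Lemma dotC x y : dot x y = dot y x.
Proof. by apply: eq_bigr => k _; rewrite mulrC. Qed.

Lemma dot_cross x y z : dot (cross x y) z = dot x (cross y z).
Proof. rewrite !dotE !crossE; ring. Qed.

Lemma dot_crossl x y : dot (cross x y) x = 0.
Proof. rewrite !dotE !crossE; ring. Qed.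

Lemma dot_crossr x y : dot (cross x y) y = 0.
Proof. rewrite !dotE !crossE; ring. Qed.

Lemma crossC x y : cross x y = - cross y x.
Proof. by apply/rowP; apply: forall_ord3; rewrite !mxE /=; ring. Qed.

Lemma dot_crossx x y z w :
  dot x z * dot y w - dot x w * dot y z = dot (cross x y) (cross z w).
Proof. rewrite !dotE !crossE; ring. Qed.

Lemma crossA x y z : cross x (cross y z) = dot x z *: y - dot x y *: z.
Proof. by apply/rowP; apply: forall_ord3; rewrite !mxE /= !dotE ?mxE /=; ring. Qed.

Lemma cross_eq0_dot x y v : cross x y = 0 -> x != 0 -> dot x v = 0 -> dot y v = 0.
Proof.
move=> xy x0 xv; have /rV0Pn [k xk] := x0.
have h j : x 0 k * y 0 j = y 0 k * x 0 j.
  { move: k j {xk}; apply: forall_ord3; apply: forall_ord3; try by rewrite mulrC.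
  all: move/rowP: xy => xy; have := xy 0; have := xy 1; have := xy 2%:R.
  all: rewrite !crossE !mxE => /eqP + /eqP + /eqP.
  all: rewrite !subr_eq0 => /eqP h1 /eqP h2 /eqP h3.
  all: by rewrite [RHS]mulrC; first [exact: h1
    |exact: h2|exact: h3|exact: esym h1|exact: esym h2|exact: esym h3]. }
apply: (mulfI xk); rewrite mulr0 /dot big_distrr /=.
under eq_bigr => j _ do rewrite mulrA h -mulrA.
by rewrite -big_distrr /= -/(dot x v) xv mulr0.
Qed.

Lemma exists_orthogonal x : exists2 y, y != 0 & dot x y = 0.
Proof.
have [h|h] := eqVneq (cross x (delta_mx 0 0)) 0; last first.
  by exists (cross x (delta_mx 0 0)); rewrite // dotC dot_crossl.
exists (delta_mx 0 1); last first.
  rewrite dotE !mxE /= !mulr0 mulr1 add0r addr0.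
  move/rowP/(_ 2%:R): h; rewrite crossE !mxE /= mulr0 mulr1 add0r.
  by move/eqP; rewrite oppr_eq0 => /eqP.
by apply/rV0Pn; exists 1; rewrite mxE !eqxx oner_neq0.
Qed.

Lemma exists_dot1 x : x != 0 -> exists y, dot x y = 1.
Proof.
move=> /rV0Pn [k xk]; exists ((x 0 k)^-1 *: delta_mx 0 k).
rewrite /dot (bigD1 k) //= !mxE !eqxx mulr1 divff // big1 ?addr0 // => j jk.
by rewrite !mxE (negbTE jk) !mulr0.
Qed.

Lemma row3_neq0 x y : dot x y != 0 -> x != 0.
Proof.
by apply: contraNneq => ->; rewrite /dot big1 // => k _; rewrite mxE mul0r.
Qed.

(** The last clause is the matrix product in the other order; it expresses vectors and variables
    through [A], [B], [c]. *)
Definition dual_bases (a b e A B c : 'rV[K]_3) : Prop :=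
  [/\ [/\ dot A a = 1, dot A b = 0 & dot A e = 0],
      [/\ dot B a = 0, dot B b = 1 & dot B e = 0],
      [/\ dot c a = 0, dot c b = 0 & dot c e = 1]
    & forall j k, a 0 k * A 0 j + b 0 k * B 0 j + e 0 k * c 0 j = (j == k)%:R].

Lemma dual_bases_cross a b e c : cross a b = c -> dot c e = 1 ->
  dual_bases a b e (cross b e) (cross e a) c.
Proof.
move=> abc ce; have Aa : dot (cross b e) a = 1.
  by rewrite dotC -dot_cross abc.
have Bb : dot (cross e a) b = 1 by rewrite dot_cross abc dotC.
have ca : dot c a = 0 by rewrite -abc dot_crossl.
have cb : dot c b = 0 by rewrite -abc dot_crossr.
split; rewrite ?Aa ?Bb ?ca ?cb ?dot_crossl ?dot_crossr //.
pose M := \matrix_(i < 3) (if i == 0 then a else if i == 1 then b else e).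
pose N := (\matrix_(i < 3)
  (if i == 0 then cross b e else if i == 1 then cross e a else c))^T.
have : M *m N = 1%:M.
  apply/matrixP => i j; rewrite !mxE; transitivity
    (dot (if j == 0 then cross b e else if j == 1 then cross e a else c)
         (if i == 0 then a else if i == 1 then b else e)).
    by apply: eq_bigr => k _; rewrite !mxE mulrC.
  by move: i j; apply: forall_ord3; apply: forall_ord3;
     rewrite /= ?Aa ?Bb ?ca ?cb ?ce ?dot_crossl ?dot_crossr.
move/mulmx1C/matrixP => h j k; have := h j k.
rewrite !mxE sum_ord3 !mxE /= => <-.
by congr (_ + _ + _); rewrite mulrC.
Qed.

(** If [dot a u = 1], the triple product formula gives a x (c x u) = (a.u) c - (a.c) u = c, so
    [cross c u] is the second point on the line. *)
Lemma exists_dual_bases a c : a != 0 -> c != 0 -> dot c a = 0 ->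
  exists b e A B, cross a b = c /\ dual_bases a b e A B c.
Proof.
move=> a0 c0 ca; have [u au] := exists_dot1 a0; have [e ce] := exists_dot1 c0.
have abc : cross a (cross c u) = c.
  by rewrite crossA au (dotC a) ca scale1r scale0r subr0.
exists (cross c u), e, (cross (cross c u) e), (cross e a).
by split=> //; apply: dual_bases_cross.
Qed.

End Vectors.

Section Line.
Variable K : numFieldType.
Local Notation R := {mpoly K[3]}.
Implicit Types (g h : R) (z : 'rV[K]_3) (p q : {poly K}).

Definition lform z : R := \sum_k z 0 k *: 'X_k.

Lemma lform_homog z : lform z \is 1.-homog.
Proof.
by apply: rpred_sum => k _; apply: rpredZ; rewrite dhomogX; apply/eqP/mdeg1.
Qed.

Lemma meval_lform z (v : 'rV[K]_3) : (lform z).@[fun k => v 0 k] = dot z v.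
Proof.
by rewrite /lform rmorph_sum /=; apply: eq_bigr => k _; rewrite mevalZ mevalXU.
Qed.

Lemma mderiv_lform z k : (lform z)^`M(k) = (z 0 k)%:MP.
Proof.
rewrite /lform raddf_sum (bigD1 k) //= big1 ?addr0 => [|j jk]; rewrite mderivZ mderivX.
  have -> : (U_(k) - U_(k) = 0 :> 'X_{1..3})%MM.
    by apply/mnmP => i; rewrite mnmBE subnn mnm0E.
  by rewrite mnmE eqxx mpolyX0 scale1r -mul_mpolyC mulr1.
by rewrite mnmE (negbTE jk) scale0r scaler0.
Qed.

Lemma lform_coef z k : (lform z)@_(U_(k)) = z 0 k.
Proof.
rewrite /lform raddf_sum (bigD1 k) //= big1 ?addr0 => [|j jk]; rewrite mcoeffZ mcoeffXU.
  by rewrite eqxx mulr1.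
by rewrite (negbTE jk) mulr0.
Qed.

Lemma lform_eq0 z : (lform z == 0) = (z == 0).
Proof.
apply/eqP/eqP => [h|->]; last by rewrite /lform big1 // => k _; rewrite mxE scale0r.
by apply/rowP => k; rewrite -lform_coef h mcoeff0 mxE.
Qed.

Lemma homog1_lform g : g \is 1.-homog -> g = lform (\row_k g@_(U_(k))).
Proof.
move=> hg; apply/mpolyP => u.
have [u1|u1] := eqVneq (mdeg u) 1%N.
  by have /eqP/mdeg1P [k /eqP ->] := u1; rewrite lform_coef mxE.
by rewrite (dhomog_nemf_coeff hg) // (dhomog_nemf_coeff (lform_homog _)).
Qed.

Section Restriction.
Variables a b : 'rV[K]_3.

Definition restr g : {poly K} :=
  mmap (@polyC K) (fun k => a 0 k *: 'X + (b 0 k)%:P) g.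

HB.instance Definition _ := GRing.RMorphism.copy restr
  (mmap (@polyC K) (fun k => a 0 k *: 'X + (b 0 k)%:P)).

Lemma restrX k : restr 'X_k = a 0 k *: 'X + (b 0 k)%:P.
Proof. by rewrite /restr mmapX mmap1U. Qed.

Lemma restrZ c g : restr (c *: g) = c *: restr g.
Proof. by rewrite /restr mmapZ mul_polyC. Qed.

Lemma restr_lform z : restr (lform z) = dot z a *: 'X + (dot z b)%:P.
Proof.
rewrite /lform rmorph_sum /=.
under eq_bigr => k _ do rewrite restrZ restrX scalerDr scalerA -[X in _ + X]mul_polyC -polyCM.
rewrite big_split /= -scaler_suml; congr (_ + _).
by rewrite -rmorph_sum.
Qed.

Lemma size_linear (l n : K) : (size (l *: 'X + n%:P)%R <= 2)%N.
Proof.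
rewrite (leq_trans (size_polyD _ _)) // geq_max (leq_trans (size_scale_leq _ _)) ?size_polyX //.
by rewrite (leq_trans (size_polyC_leq1 _)).
Qed.

Lemma size_restr n g : g \is n.-homog -> (size (restr g) <= n.+1)%N.
Proof.
move: n g; apply: (@dhomog_ind3 _ (fun n g => (size (restr g) <= n.+1)%N)).
- by move=> n; rewrite rmorph0 size_poly0.
- move=> n c g h sg sh; rewrite rmorphD /= restrZ (leq_trans (size_polyD _ _)) //.
  by rewrite geq_max sh (leq_trans (size_scale_leq _ _)).
- by rewrite rmorph1 size_poly1.
move=> n k g _ sg; rewrite rmorphM /= restrX.
by rewrite (leq_trans (size_mul_le (size_linear _ _) sg)).
Qed.

End Restriction.

Section Frame.
Variables a b e A B c : 'rV[K]_3.
Hypothesis frame : dual_bases a b e A B c.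
Local Notation rho := (restr a b).

(** Homogenization with [A] for the variable and [B] as homogenizing form, a section of [restr].
    Since [A] and [B] vanish at [e], the result has zero derivative in that direction. *)
Definition homz n p : R :=
  \sum_(i < n.+1) p`_i *: (lform A ^+ i * lform B ^+ (n - i)).

Lemma homz_homog n p : homz n p \is n.-homog.
Proof.
apply: rpred_sum => i _; apply: rpredZ.
have := dhomogM (dhomogMn i (lform_homog A)) (dhomogMn (n - i) (lform_homog B)).
by rewrite !mul1n subnKC // -ltnS.
Qed.

Lemma homz0 n : homz n 0 = 0.
Proof. by rewrite /homz big1 // => i _; rewrite coef0 scale0r. Qed.

Lemma homz_lin n l p q : homz n (l *: p + q) = l *: homz n p + homz n q.
Proof.
rewrite /homz scaler_sumr -big_split /=; apply: eq_bigr => i _.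
by rewrite coefD coefZ scalerDl scalerA.
Qed.

Lemma restr_A : rho (lform A) = 'X.
Proof. by rewrite restr_lform; case: frame => -[-> -> _] _ _ _; rewrite scale1r addr0. Qed.
Lemma restr_B : rho (lform B) = 1.
Proof. by rewrite restr_lform; case: frame => _ [-> -> _] _ _; rewrite scale0r add0r. Qed.
Lemma restr_c : rho (lform c) = 0.
Proof. by case: frame => _ _ [ca cb _] _; rewrite restr_lform ca cb scale0r add0r. Qed.

Lemma restr_homz n p : (size p <= n.+1)%N -> rho (homz n p) = p.
Proof.
move=> sp; rewrite /homz rmorph_sum /= -[RHS](coefK p).
rewrite (poly_def (size p)) (big_ord_widen _ (fun i => p`_i *: 'X^i) sp) [RHS]big_mkcond /=.
apply: eq_bigr => i _; rewrite restrZ rmorphM !rmorphXn /= restr_A restr_B.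
rewrite expr1n mulr1; case: ifP => // /negbT; rewrite -leqNgt => /(nth_default 0) ->.
by rewrite scale0r.
Qed.

Lemma homz_mul_lin n l u p : (size p <= n.+1)%N ->
  homz n.+1 ((l *: 'X + u%:P) * p) = (l *: lform A + u *: lform B) * homz n p.
Proof.
move=> sp; rewrite mulrDl -scalerAl homz_lin mulrDl mul_polyC -[u *: p]addr0.
rewrite homz_lin homz0 addr0 -!scalerAl; congr (_ *: _ + _ *: _).
  rewrite /homz big_ord_recl coefXM scale0r add0r mulr_sumr.
  apply: eq_bigr => i _; rewrite coefXM /= -scalerAr mulrA -exprS.
  by rewrite /bump add1n subSS.
rewrite /homz big_ord_recr /= [p`_n.+1]nth_default // scale0r addr0 mulr_sumr.
apply: eq_bigr => i _; rewrite -scalerAr mulrCA -exprS subSn //.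
by rewrite -ltnS.
Qed.

Lemma variable_frame k : 'X_k = a 0 k *: lform A + b 0 k *: lform B + e 0 k *: lform c.
Proof.
case: frame => _ _ _ h; rewrite /lform !scaler_sumr -!big_split /=.
rewrite (bigD1 k) //= big1 ?addr0 => [|j jk]; rewrite !scalerA -!scalerDl h.
  by rewrite eqxx scale1r.
by rewrite (negbTE jk) scale0r.
Qed.

(** By induction on forms: a variable is a combination of [A], [B] and [c]; multiplying by the first
    two commutes with homogenization, and the third only adds a multiple of [c]. The quotient is 0
    in degree 0. *)
Lemma homz_mod n g : g \is n.-homog -> exists eta,
  g = homz n (rho g) + lform c * eta /\
  (if n is n'.+1 then eta \is n'.-homog else eta = 0).
Proof.
move=> hg; pose Q n g := g \is n.-homog /\ exists eta,
  g = homz n (rho g) + lform c * eta /\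
  (if n is n'.+1 then eta \is n'.-homog else eta = 0).
suff : Q n g by case.
move: n g hg; apply: dhomog_ind3.
- move=> n; split; first exact: rpred0.
  exists 0; rewrite rmorph0 homz0 mulr0 addr0; split=> //.
  by case: n => // n; apply: rpred0.
- move=> n l g h [hg [u [gE hu]]] [hh [v [hE hv]]].
  split; first by rewrite rpredD // rpredZ.
  exists (l *: u + v); rewrite rmorphD /= restrZ homz_lin; split.
    rewrite {1}gE {1}hE -!mul_mpolyC; ring.
  case: n hu hv {hg hh gE hE} => [|n] => [-> ->|hu hv].
    by rewrite scaler0 addr0.
  by rewrite rpredD // rpredZ.
- split; first exact: dhomog1.
  exists 0; split=> //; rewrite mulr0 addr0 rmorph1 /homz big_ord1 coef1 /=.
  by rewrite !expr0 mulr1 scale1r.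
move=> n k g hg [_ [u [gE hu]]].
have hX : ('X_k : R) \is 1.-homog by rewrite dhomogX; apply/eqP/mdeg1.
split; first exact: (dhomogM hX hg).
exists (e 0 k *: g + (a 0 k *: lform A + b 0 k *: lform B) * u); split.
  rewrite rmorphM /= restrX homz_mul_lin ?size_restr //.
  rewrite {1}variable_frame {1}mulrDl {1}gE -!mul_mpolyC; ring.
apply: rpredD; first exact: rpredZ.
case: n hu {gE hg} => [->|n hu]; first by rewrite mulr0 rpred0.
have hl : a 0 k *: lform A + b 0 k *: lform B \is 1.-homog.
  by rewrite rpredD // rpredZ // lform_homog.
exact: (dhomogM hl hu).
Qed.

Lemma restr_eq0 n g : g \is n.+1.-homog -> rho g = 0 ->
  exists2 eta, eta \is n.-homog & g = lform c * eta.
Proof.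
move=> hg g0; have [eta [gE heta]] := homz_mod hg; exists eta => //.
by rewrite gE g0 homz0 add0r.
Qed.

Lemma restr_eq00 g : g \is 0.-homog -> rho g = 0 -> g = 0.
Proof.
move=> hg g0; have [eta [gE heta]] := homz_mod hg.
by rewrite gE g0 homz0 add0r heta mulr0.
Qed.

End Frame.
End Line.

(** * Sums of powers divisible by the square of a linear form *)

Section SquareMultiples.
Variable K : numFieldType.
Local Notation R := {mpoly K[3]}.
Implicit Types (g h : R) (p q : {poly K}) (a b c e u v : 'rV[K]_3).

Definition dirder e h : R := \sum_k e 0 k *: h^`M(k).

Lemma dirderD e g h : dirder e (g + h) = dirder e g + dirder e h.
Proof.
by rewrite -big_split; apply: eq_bigr => k _; rewrite mderivD scalerDr.
Qed.

Lemma dirderZ e l h : dirder e (l *: h) = l *: dirder e h.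
Proof.
by rewrite scaler_sumr; apply: eq_bigr => k _; rewrite mderivZ !scalerA mulrC.
Qed.

Lemma dirder0 e : dirder e 0 = 0.
Proof. by rewrite -(scale0r (0 : R)) dirderZ !scale0r. Qed.

Lemma dirder_sum e (I : Type) (r : seq I) (F : I -> R) :
  dirder e (\sum_(i <- r) F i) = \sum_(i <- r) dirder e (F i).
Proof. by elim/big_rec2: _ => [|i y x _ <-]; rewrite ?dirder0 ?dirderD. Qed.

Lemma dirderM e g h : dirder e (g * h) = dirder e g * h + g * dirder e h.
Proof.
rewrite /dirder mulr_suml mulr_sumr -big_split; apply: eq_bigr => k _ /=.
by rewrite mderivM scalerDr scalerAl scalerAr.
Qed.

Lemma dirder_exp e g n : dirder e (g ^+ n) = n%:R *: (g ^+ n.-1 * dirder e g).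
Proof.
rewrite /dirder mulr_sumr scaler_sumr; apply: eq_bigr => k _.
by rewrite mderiv_exp -scalerAr !scalerA mulrC.
Qed.

Lemma dirder_lform e c : dirder e (lform c) = (dot c e)%:MP.
Proof.
rewrite /dirder /dot raddf_sum; apply: eq_bigr => k _.
by rewrite mderiv_lform /= -mul_mpolyC -mpolyCM mulrC.
Qed.

Lemma dirder_homog e n h : h \is n.+1.-homog -> dirder e h \is n.-homog.
Proof.
move=> hh; apply: rpred_sum => k _; apply: rpredZ; apply/dhomogP => u.
rewrite mcoeff_msupp mcoeff_mderiv; have [du|du] := eqVneq (mdeg u) n; first by [].
rewrite (dhomog_nemf_coeff hh) ?mul0rn ?eqxx //=.
by rewrite mdegD mdeg1 addn1 eqSS.
Qed.

Lemma coef_linear_exp (l u : K) n k : (k <= n)%N ->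
  ((l *: 'X + u%:P) ^+ n)`_(n - k) = 'C(n, k)%:R * (l ^+ (n - k) * u ^+ k).
Proof.
move=> kn; rewrite exprDn coef_sum (bigD1 (Ordinal (kn : k < n.+1)%N)) //= big1.
  rewrite addr0 coefMn exprZn -rmorphXn /= coefMC coefZ coefXn eqxx.
  by rewrite mulr1 mulr_natl.
move=> i ik; rewrite coefMn exprZn -rmorphXn /= coefMC coefZ coefXn.
case: eqP => [E|]; last by rewrite mulr0 mul0r mul0rn.
case/eqP: ik; apply: val_inj => /=; have := ltn_ord i; lia.
Qed.

Variables (d : nat) (z : 'I_(d.+1 + d) -> 'rV[K]_3).
Local Notation m := (d.+1 + d)%N.

(** Both sides of the duality in one matrix: its right kernel consists of the combinations of powers
    with zero jet, its left kernel of the lattice elements in [lattice_le d]. The powers of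
    [dot (z i) a] clear the denominators of the parameters, so that the entries are polynomial in
    [a] and [b]. *)
Definition power_mx a b e : 'M[K]_m :=
  col_mx (\matrix_(k < d.+1, i < m) (dot (z i) a ^+ (d - k) * (- dot (z i) b) ^+ k))
         (\matrix_(k < d, i < m)
            (dot (z i) e * (dot (z i) a ^+ (d.-1 - k) * (- dot (z i) b) ^+ k))).

(* The rescaled coefficients of h and of its derivative in the direction e on
   the line through a and b: together they are the class of h modulo the
   square of the equation of that line. *)
Definition jet a b e h : 'cV[K]_m :=
  col_mx (\col_(k < d.+1)
            ((-1) ^+ k / 'C(d, k)%:R * (restr a b h)`_(d - k)))
         (\col_(k < d)
            ((-1) ^+ k / (d * 'C(d.-1, k))%:R * (restr a b (dirder e h))`_(d.-1 - k))).

Definition power_comb (x : 'cV[K]_m) : R := \sum_i x i 0 *: lform (z i) ^+ d.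

Lemma power_comb_homog x : power_comb x \is d.-homog.
Proof.
apply: rpred_sum => i _; apply: rpredZ.
by have := dhomogMn d (lform_homog (z i)); rewrite mul1n.
Qed.

Hypothesis d_gt0 : (0 < d)%N.

Lemma bin_neq0 n k : (k <= n)%N -> 'C(n, k)%:R != 0 :> K.
Proof. by move=> kn; rewrite pnatr_eq0 -lt0n bin_gt0. Qed.

Lemma jetD a b e g h : jet a b e (g + h) = jet a b e g + jet a b e h.
Proof.
rewrite /jet dirderD !rmorphD /= add_col_mx.
by congr col_mx; apply/colP => k; rewrite !mxE coefD mulrDr.
Qed.

(** The factors in [jet] cancel the binomial coefficients of the expanded power of a linear
    polynomial, the d from differentiation, and the sign of its constant term. *)
Lemma jet_power_comb a b e x : jet a b e (power_comb x) = power_mx a b e *m x.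
Proof.
rewrite /jet /power_mx mul_col_mx; congr col_mx; apply/colP => k; rewrite !mxE.
  rewrite rmorph_sum coef_sum mulr_sumr; apply: eq_bigr => i _ /=.
  rewrite mxE restrZ coefZ rmorphXn /= restr_lform coef_linear_exp; last by rewrite -ltnS.
  have := bin_neq0 (leq_ord k); rewrite [in RHS]exprNn => k0.
  by field.
have kd : (k <= d.-1)%N by have := ltn_ord k; lia.
rewrite dirder_sum rmorph_sum coef_sum mulr_sumr; apply: eq_bigr => i _ /=.
rewrite mxE dirderZ dirder_exp dirder_lform [_ * _%:MP_[_]]mulrC mul_mpolyC !restrZ !coefZ.
rewrite rmorphXn /= restr_lform coef_linear_exp //.
have := bin_neq0 kd; rewrite [in RHS]exprNn natrM => k0.
have d0 : d%:R != 0 :> K by rewrite pnatr_eq0 -lt0n.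
by field; rewrite k0.
Qed.

Lemma jet_square a b e c g : dot c a = 0 -> dot c b = 0 ->
  jet a b e (lform c ^+ 2 * g) = 0.
Proof.
move=> ca cb; have rc : restr a b (lform c) = 0.
  by rewrite restr_lform ca cb scale0r add0r.
have r1 : restr a b (lform c ^+ 2 * g) = 0.
  by rewrite rmorphM rmorphXn /= rc expr0n mul0r.
have r2 : restr a b (dirder e (lform c ^+ 2 * g)) = 0.
  by rewrite expr2 -mulrA dirderM rmorphD !rmorphM /= rc !mul0r mulr0 addr0.
rewrite /jet r1 r2 -[RHS]vsubmxK; congr col_mx; apply/colP => k.
  by rewrite !mxE coef0 mulr0.
by rewrite !mxE coef0 mulr0.
Qed.

Section Frame.
Variables a b e A B c : 'rV[K]_3.
Hypothesis frame : dual_bases a b e A B c.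

Lemma dirder_homz n p : dirder e (homz A B n p) = 0.
Proof.
have [[_ _ Ae] [_ _ Be] _ _] := frame.
rewrite /homz dirder_sum big1 // => i _; rewrite dirderZ dirderM !dirder_exp.
by rewrite !dirder_lform Ae Be mpolyC0 !(mulr0, scaler0, mul0r, addr0).
Qed.

(** Vanishing on the line gives h = c eta. There the derivative along [e] restricts to eta, because
    [dot c e = 1], so [c] divides eta as well. For d = 1 eta is a constant, hence 0; this case is
    separate because [d - 2] truncates. *)
Lemma jet_eq0 h : h \is d.-homog -> jet a b e h = 0 ->
  exists g, [/\ h = lform c ^+ 2 * g, (1 < d)%N -> g \is (d - 2).-homog
    & d = 1%N -> h = 0].
Proof.
move=> hh h0; have [_ _ [_ _ ce] _] := frame.
have r1 : restr a b h = 0.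
  apply/polyP => j; rewrite coef0; have [dj|jd] := ltnP d j.
    by rewrite nth_default // (leq_trans (size_restr a b hh)).
  have kd : (d - j < d.+1)%N by lia.
  move/(congr1 usubmx)/colP/(_ (Ordinal kd)): h0; rewrite col_mxKu !mxE /= subKn //.
  move/eqP; rewrite mulf_eq0 mulf_eq0 signr_eq0 invr_eq0 (negbTE (bin_neq0 (leq_subr _ _))).
  by move/eqP.
have dhh : dirder e h \is (d.-1).-homog by apply: dirder_homog; rewrite prednK.
have r2 : restr a b (dirder e h) = 0.
  apply/polyP => j; rewrite coef0; have [dj|jd] := ltnP d.-1 j.
    by rewrite nth_default // (leq_trans (size_restr a b dhh)).
  have kd : (d.-1 - j < d)%N by lia.
  move/(congr1 dsubmx)/colP/(_ (Ordinal kd)): h0; rewrite col_mxKd !mxE /= subKn //.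
  move/eqP; rewrite mulf_eq0 mulf_eq0 signr_eq0 invr_eq0 natrM mulf_eq0 pnatr_eq0.
  by rewrite (negbTE (bin_neq0 (leq_subr _ _))) -[d == _]negbK -lt0n d_gt0 => /eqP.
have [eta heta hE] : exists2 eta, eta \is d.-1.-homog & h = lform c * eta.
  by apply: (restr_eq0 frame) => //; rewrite prednK.
have eta0 : restr a b eta = 0.
  move: r2; rewrite hE dirderM dirder_lform ce mul1r rmorphD rmorphM /=.
  by rewrite (restr_c frame) mul0r addr0.
have [d2|d1'] := ltnP 1 d; last first.
  have d1 : d = 1%N by lia.
  have e0 : eta = 0 by apply: (restr_eq00 frame) => //; move: heta; rewrite d1.
  by exists 0; rewrite hE e0 !mulr0; split=> //; rewrite d1.
have d12 : d.-1 = (d - 2).+1 by lia.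
have [g hg etaE] : exists2 g, g \is (d - 2).-homog & eta = lform c * g.
  by apply: (restr_eq0 frame) => //; rewrite -d12.
exists g; split=> [|//|d1]; first by rewrite hE etaE mulrA expr2.
by move: d2; rewrite d1.
Qed.

(** Values and normal derivatives can be prescribed independently: a form in [A] and [B] has no
    normal derivative, and a multiple of [c] has no value on the line. *)
Lemma jet_onto (y : 'cV[K]_m) : exists2 h, h \is d.-homog & jet a b e h = y.
Proof.
pose p := \poly_(j < d.+1) ((-1) ^+ (d - j) * 'C(d, d - j)%:R * y (lshift d (inord (d - j))) 0).
pose q := \poly_(j < d) (if insub (d.-1 - j)%N is Some k
   then (-1) ^+ (d.-1 - j) * (d * 'C(d.-1, d.-1 - j))%:R * y (rshift d.+1 k) 0 else 0).
have hc : lform c * homz A B d.-1 q \is d.-homog.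
  by have := dhomogM (lform_homog c) (homz_homog A B d.-1 q); rewrite add1n prednK.
exists (homz A B d p + lform c * homz A B d.-1 q).
  by rewrite rpredD // homz_homog.
have [_ _ [_ _ ce] _] := frame.
have sq : (size q <= d.-1.+1)%N by rewrite prednK // size_poly.
rewrite /jet dirderD dirder_homz dirderM dirder_homz mulr0 add0r addr0.
rewrite dirder_lform ce mul1r rmorphD rmorphM /= (restr_c frame) mul0r addr0.
rewrite !(restr_homz frame) ?size_poly // -[RHS]vsubmxK.
have sgn2 k : (-1) ^+ k * (-1) ^+ k = 1 :> K by rewrite -exprD -signr_odd addnn odd_double.
congr col_mx; apply/colP => k; rewrite !mxE coef_poly.
  rewrite ltnS leq_subr subKn -1?ltnS // inord_val.
  have := bin_neq0 (leq_ord k) => k0.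
  rewrite mulrACA -mulrA [_^-1 * _]mulrC !mulrA sgn2 mul1r -mulrA mulrCA mulfV // mulr1.
  by [].
have kd : (k <= d.-1)%N by have := ltn_ord k; lia.
have -> : (d.-1 - k < d)%N by lia.
rewrite subKn // insubT //= => kd'.
have nz : (d * 'C(d.-1, k))%:R != 0 :> K.
  by rewrite natrM mulf_neq0 ?bin_neq0 // pnatr_eq0 -lt0n.
rewrite mulrACA -mulrA [_^-1 * _]mulrC !mulrA sgn2 mul1r -mulrA mulrCA mulfV // mulr1.
by congr (y _ _); apply: val_inj.
Qed.

Lemma power_mx_singular : \det (power_mx a b e) = 0 <->
  exists x, x != 0 /\ exists g, [/\ power_comb x = lform c ^+ 2 * g,
    (1 < d)%N -> g \is (d - 2).-homog & d = 1%N -> power_comb x = 0].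
Proof.
split.
  rewrite -det_tr => /eqP/det0P [v v0 vM]; exists v^T; split.
    by apply: contra v0 => /eqP v0; rewrite -[v]trmxK v0 trmx0.
  apply: jet_eq0; first exact: power_comb_homog.
  by rewrite jet_power_comb -[_ *m _]trmxK trmx_mul trmxK vM trmx0.
move=> [x [x0 [g [xE _ _]]]]; apply/eqP; rewrite -det_tr; apply/det0P; exists x^T.
  by apply: contra x0 => /eqP x0; rewrite -[x]trmxK x0 trmx0.
rewrite -trmx_mul -jet_power_comb xE jet_square ?trmx0 //; by case: frame => _ _ [].
Qed.

(** A left kernel vector annihilates the jets of all combinations of powers and of all multiples of
    the square, but not every jet, and every jet is attained. *)
Lemma power_mx_not_onto : \det (power_mx a b e) = 0 ->
  exists2 h, h \is d.-homog & forall x g, h <> power_comb x + lform c ^+ 2 * g.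
Proof.
move=> /eqP/det0P [v v0 vM]; have /rV0Pn [k vk] := v0.
have [h hh hE] := jet_onto (delta_mx k 0); exists h => // x g hxg.
have [_ _ [ca cb _] _] := frame.
have : v *m jet a b e h = 0.
  by rewrite hxg jetD jet_square // addr0 jet_power_comb mulmxA vM mul0mx.
rewrite hE => /matrixP/(_ 0 0); rewrite !mxE (bigD1 k) //= big1 => [|j jk].
  by rewrite mxE !eqxx mulr1 addr0 => /eqP; rewrite (negbTE vk).
by rewrite mxE (negbTE jk) mulr0.
Qed.

Hypothesis za_neq0 : forall i, dot (z i) a != 0.

(** Up to the nonzero factor [dot (z i) a ^+ d.-1], column [i] is the [i]-th lattice condition on
    the coefficients of a pair of polynomials. *)
Lemma power_mx_lattice : \det (power_mx a b e) = 0 <->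
  exists2 x, x != 0 & lattice_le (fun i => dot (z i) a) (fun i => dot (z i) e)
    (fun i => - dot (z i) b / dot (z i) a) d x.
Proof.
pose t i := - dot (z i) b / dot (z i) a.
have entry (v : 'rV[K]_m) i : (v *m power_mx a b e) 0 i =
    dot (z i) a ^+ d.-1 * (dot (z i) a * (rVpoly (lsubmx v)).[t i]
       + dot (z i) e * (rVpoly (rsubmx v)).[t i]).
  have ta k : (- dot (z i) b) ^+ k = t i ^+ k * dot (z i) a ^+ k.
    by rewrite -exprMn divfK.
  rewrite -{1}[v]hsubmxK mul_row_col mxE mulrDr; congr (_ + _).
    rewrite mxE (horner_coef_wide _ (size_poly _ _)) !big_distrr /=.
    apply: eq_bigr => k _; rewrite !mxE coef_rVpoly_ord ta mxE.
    have -> : dot (z i) a ^+ (d - k) * (t i ^+ k * dot (z i) a ^+ k) =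
       dot (z i) a ^+ d * t i ^+ k.
      by rewrite mulrCA -exprD subnK 1?mulrC // -ltnS.
    have -> : dot (z i) a ^+ d = dot (z i) a ^+ d.-1 * dot (z i) a.
      by rewrite -exprSr prednK.
    by ring.
  rewrite mxE (horner_coef_wide _ (size_poly _ _)) !big_distrr /=.
  apply: eq_bigr => k _; rewrite !mxE coef_rVpoly_ord ta mxE.
  have kd : (k <= d.-1)%N by have := ltn_ord k; lia.
  have -> : dot (z i) a ^+ (d.-1 - k) * (t i ^+ k * dot (z i) a ^+ k) =
     dot (z i) a ^+ d.-1 * t i ^+ k.
    by rewrite mulrCA -exprD subnK 1?mulrC.
  by ring.
split.
  move/eqP/det0P => [v v0 vM]; exists (rVpoly (lsubmx v), rVpoly (rsubmx v)).
    apply: contra v0 => /eqP [h1 h2]; rewrite -[v]hsubmxK.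
    rewrite -[lsubmx v]rVpolyK -[rsubmx v]rVpolyK.
    by rewrite (_ : rVpoly _ = 0) // (_ : rVpoly (rsubmx v) = 0) // !linear0 row_mx0.
  split=> [i||]; rewrite ?size_poly //=.
  have /eqP := entry v i; rewrite vM mxE eq_sym mulf_eq0 expf_eq0.
  by rewrite (negbTE (za_neq0 i)) andbF => /eqP.
move=> [x x0 [hx x1 x2]]; apply/eqP/det0P.
exists (row_mx (poly_rV x.1) (poly_rV x.2)).
  apply: contra x0 => /eqP h; apply/eqP.
  have h1 : poly_rV x.1 = 0 :> 'rV_d.+1.
    by rewrite -(row_mxKl (poly_rV x.1) (poly_rV x.2 : 'rV_d)) h linear0.
  have h2 : poly_rV x.2 = 0 :> 'rV_d.
    by rewrite -(row_mxKr (poly_rV x.1 : 'rV_d.+1) (poly_rV x.2)) h linear0.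
  by rewrite [x]surjective_pairing -(poly_rV_K x1) -(poly_rV_K x2) h1 h2 !linear0.
apply/rowP => i; rewrite entry row_mxKl row_mxKr !poly_rV_K // (hx i) mulr0 mxE //.
Qed.

End Frame.

(* For fixed u, v, e the determinant of power_mx (cross c u) (cross c v) e is
   polynomial in c, so it vanishes everywhere if it vanishes generically. *)
Lemma power_mx_generic (P : R) : P != 0 ->
  (forall c, c != 0 -> P.@[fun k => c 0 k] != 0 ->
     exists x, x != 0 /\ exists g, power_comb x = lform c ^+ 2 * g) ->
  forall c, c != 0 ->
  exists a b e A B, dual_bases a b e A B c /\ \det (power_mx a b e) = 0.
Proof.
move=> P0 generic c0 c0_neq0.
have [a a0 ca] := exists_orthogonal c0.
have [b [e [A [B [_ frame]]]]] := exists_dual_bases a0 c0_neq0 ca.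
exists a, b, e, A, B; split=> //.
(* Since c0 x (a x e) = (c0.e) a - (c0.a) e = a, and likewise for [b], the given frame is the value
   at [c0] of a family that is linear in [c]. *)
pose u := cross a e; pose v := cross b e.
have [_ _ [_ cb ce] _] := frame.
have aE : a = cross c0 u by rewrite crossA ce ca scale1r scale0r subr0.
have bE : b = cross c0 v by rewrite crossA ce cb scale1r scale0r subr0.
pose D : 'M[R]_m :=
  col_mx (\matrix_(k < d.+1, i < m)
            (lform (cross u (z i)) ^+ (d - k) * (- lform (cross v (z i))) ^+ k))
         (\matrix_(k < d, i < m)
            ((dot (z i) e)%:MP * (lform (cross u (z i)) ^+ (d.-1 - k)
               * (- lform (cross v (z i))) ^+ k))).
have DE (c : 'rV[K]_3) : map_mx (meval (fun k => c 0 k)) D = power_mx (cross c u) (cross c v) e.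
  have h x i : dot (z i) (cross c x) = dot (cross x (z i)) c.
    by rewrite dotC dot_cross dotC.
  rewrite /D map_col_mx; congr col_mx; apply/matrixP => k i; rewrite !mxE.
    rewrite !rmorphM !rmorphXn rmorphN /= !meval_lform.
    by rewrite !h.
  rewrite !rmorphM !rmorphXn rmorphN /= mevalC !meval_lform.
  by rewrite !h.
suff D0 : \det D = 0.
  by rewrite aE bE -DE det_map_mx D0 rmorph0.
apply/eqP; apply: contraT => D0.
(* This factor makes the point [c] chosen below nonzero. *)
have X0 : ('X_0 : R) != 0 by rewrite -msupp_eq0 msuppX.
have /exists_meval_neq0 [w] : P * \det D * 'X_0 != 0 by rewrite !mulf_neq0.
pose c := \row_k w k; rewrite (meval_eq _ (v2 := fun k => c 0 k)); last first.
  by move=> k; rewrite mxE.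
rewrite !mevalM mevalXU !mulf_eq0 !negb_or -andbA => /and3P [Pc Dc wc].
have c_neq0 : c != 0 by apply/rV0Pn; exists 0.
have [x [x0 [g xE]]] := generic c c_neq0 Pc.
case/eqP: Dc; rewrite -det_map_mx DE; apply/eqP; rewrite -det_tr; apply/det0P.
exists x^T; first by apply: contra x0 => /eqP x0; rewrite -[x]trmxK x0 trmx0.
by rewrite -trmx_mul -jet_power_comb xE jet_square ?trmx0 // dotC dot_crossl.
Qed.

End SquareMultiples.

(** * Derivations of the arrangement along a line *)

Section Arrangement.
Variable K : numFieldType.
Local Notation R := {mpoly K[3]}.
Variables (d : nat) (z : 'I_(d.+1 + d) -> 'rV[K]_3).
Local Notation m := (d.+1 + d)%N.
Implicit Types (theta : 'rV[R]_3) (y : 'rV[{poly K}]_3) (p q : {poly K}).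

Definition arrangement_poly : R := \prod_i lform (z i).
Definition jac theta : R := \sum_k theta 0 k * arrangement_poly^`M(k).

Lemma jacD theta eta : jac (theta + eta) = jac theta + jac eta.
Proof. by rewrite -big_split; apply: eq_bigr => k _; rewrite mxE mulrDl. Qed.

Lemma jacZ g theta : jac (g *: theta) = g * jac theta.
Proof. by rewrite mulr_sumr; apply: eq_bigr => k _; rewrite mxE mulrA. Qed.

Lemma jacB theta eta : jac (theta - eta) = jac theta - jac eta.
Proof. by rewrite -scaleN1r jacD jacZ mulN1r. Qed.

Lemma mderiv_arrangement k : arrangement_poly^`M(k) =
  \sum_i z i 0 k *: \prod_(j | j != i) lform (z j).
Proof.
rewrite mderiv_prod ?index_enum_uniq //; apply: eq_bigr => i _.
by rewrite mderiv_lform mul_mpolyC.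
Qed.

Lemma prod_lform_homog (P : pred 'I_m) :
  \prod_(j | P j) lform (z j) \is (#|P|).-homog.
Proof.
rewrite -sum1_card; elim/big_rec2: _ => [|j n g _ h]; first exact: dhomog1.
exact: dhomogM (lform_homog _) h.
Qed.

Lemma jac_homog n theta : (forall k, theta 0 k \is n.-homog) ->
  jac theta \is (n + d.*2).-homog.
Proof.
move=> h; apply: rpred_sum => k _; apply: dhomogM => //.
rewrite mderiv_arrangement; apply: rpred_sum => i _; apply: rpredZ.
have -> : d.*2 = #|[pred j : 'I_m | j != i]|.
  by rewrite cardC1 card_ord addSn addnn.
exact: prod_lform_homog.
Qed.

Section Frame.
Variables a b e A B c : 'rV[K]_3.
Hypothesis frame : dual_bases a b e A B c.
Hypothesis za_neq0 : forall i, dot (z i) a != 0.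
Local Notation rho := (restr a b).
Let lam i := dot (z i) a.
Let mu i := dot (z i) e.
Let t i : K := - dot (z i) b / dot (z i) a.
Hypothesis t_inj : injective t.
Local Notation lattice_le := (lattice_le lam mu t).
Local Notation in_lattice := (in_lattice lam mu t).

Let lin i : {poly K} := rho (lform (z i)).
Let cof i : {poly K} := \prod_(j | j != i) lin j.
Let Phi : {poly K} := \prod_i lin i.

Lemma linE i : lin i = lam i *: ('X - (t i)%:P).
Proof.
have E : lam i * t i = - dot (z i) b by rewrite /t mulrC divfK //; exact: za_neq0.
by rewrite /lin restr_lform scalerBr -[X in _ - X]mul_polyC -polyCM E polyCN opprK.
Qed.

Lemma lin_horner i j : (lin i).[t j] = lam i * (t j - t i).
Proof. by rewrite linE hornerZ hornerXsubC. Qed.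

Lemma cof_horner i : (cof i).[t i] != 0.
Proof.
rewrite horner_prod; apply/prodf_neq0 => j ji; rewrite lin_horner mulf_neq0 ?za_neq0 //.
by rewrite subr_eq0; apply: contra ji => /eqP/t_inj ->.
Qed.

Lemma cof_horner0 i j : j != i -> (cof j).[t i] = 0.
Proof.
move=> ji; rewrite horner_prod (bigD1 i) 1?eq_sym //= lin_horner subrr.
by rewrite mulr0 mul0r.
Qed.

Lemma Phi_horner i : Phi.[t i] = 0.
Proof. by rewrite horner_prod (bigD1 i) //= lin_horner subrr mulr0 mul0r. Qed.

Lemma lin_cof i : lin i * cof i = Phi.
Proof. by rewrite [RHS](bigD1 i). Qed.

Lemma PhiE : exists2 u, u != 0 & Phi = u *: node_poly t.
Proof.
exists (\prod_i lam i); first by apply/prodf_neq0 => i _; apply: za_neq0.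
by rewrite -scaler_prod; apply: eq_bigr => i _; rewrite linE.
Qed.

Lemma size_Phi : size Phi = m.+1.
Proof. by have [u u0 ->] := PhiE; rewrite size_scale // size_node_poly. Qed.

Lemma Phi_neq0 : Phi != 0.
Proof. by rewrite -size_poly_eq0 size_Phi. Qed.

Lemma size_cof i : (size (cof i) <= m)%N.
Proof.
have := size_Phi; rewrite -(lin_cof i) size_mul; first 1 last.
- by apply: contraNneq Phi_neq0 => l0; rewrite -(lin_cof i) l0 mul0r.
- by apply: contraNneq Phi_neq0 => l0; rewrite -(lin_cof i) l0 mulr0.
by rewrite linE size_scale ?size_XsubC ?za_neq0 // => ?; plia.
Qed.

(* Of the coordinates of a restricted derivation in the basis (a, X a + b, e)
   only the first and last are kept: the middle one, the multiple of the Euler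
   derivation, is determined by them and the equation pairing = 0. *)
Definition pairing y : {poly K} := \sum_k y 0 k * rho arrangement_poly^`M(k).
Definition ycoord (v : 'rV[K]_3) y : {poly K} := \sum_k v 0 k *: y 0 k.
Definition lattice_pt y : {poly K} * {poly K} :=
  (ycoord A y - 'X * ycoord B y, ycoord c y).

Definition yvec (alpha beta gamma : {poly K}) : 'rV[{poly K}]_3 :=
  \row_k (a 0 k *: alpha + b 0 k *: beta + e 0 k *: gamma).

Lemma ycoord_yvec v al be ga :
  ycoord v (yvec al be ga) = dot v a *: al + dot v b *: be + dot v e *: ga.
Proof.
rewrite /ycoord /dot !scaler_suml -!big_split; apply: eq_bigr => k _.
by rewrite mxE !scalerDr !scalerA.
Qed.

Lemma yvecK y : yvec (ycoord A y) (ycoord B y) (ycoord c y) = y.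
Proof.
apply/rowP => k; rewrite mxE /ycoord !scaler_sumr -!big_split /=.
have [_ _ _ h] := frame.
rewrite (bigD1 k) //= big1 ?addr0 => [|j jk]; rewrite !scalerA -!scalerDl h.
  by rewrite eqxx scale1r.
by rewrite (negbTE jk) scale0r.
Qed.

Lemma lattice_pt_yvec al be ga :
  lattice_pt (yvec al be ga) = (al - 'X * be, ga).
Proof.
have [[Aa Ab Ae] [Ba Bb Be] [ca cb ce] _] := frame.
rewrite /lattice_pt !ycoord_yvec Aa Ab Ae Ba Bb Be ca cb ce.
by rewrite !scale0r !scale1r !(addr0, add0r).
Qed.

(** The Leibniz rule gives the sum of l_i(y) [cof i]. Writing b as (X a + b) - X a produces
    [be * lin i] in l_i(y), and each [lin i * cof i] equals [Phi]: this is Euler's relation on the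
    line. *)
Lemma pairing_yvec al be ga : pairing (yvec al be ga) =
  \sum_i (lam i *: (al - 'X * be) + mu i *: ga) * cof i + m%:R *: (be * Phi).
Proof.
have -> : m%:R *: (be * Phi) = \sum_(i < m) be * (lin i * cof i).
  under eq_bigr => i _ do rewrite lin_cof.
  by rewrite sumr_const card_ord scaler_nat.
rewrite -big_split /pairing /=.
under eq_bigr => k _ do rewrite mderiv_arrangement rmorph_sum mulr_sumr.
rewrite exchange_big; apply: eq_bigr => i _ /=.
under eq_bigr => k _ do rewrite restrZ rmorph_prod /= -/(cof i) -scalerAr scalerAl.
rewrite -mulr_suml mulrA -mulrDl; congr (_ * _).
rewrite -/(ycoord (z i) _) ycoord_yvec /lin restr_lform -!mul_polyC; ring.
Qed.

(** At [t i] only the term of index [i] survives, and its cofactor is nonzero there because the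
    parameters are distinct. *)
Lemma pairing_lattice y : pairing y = 0 -> in_lattice (lattice_pt y).
Proof.
rewrite -(yvecK y) lattice_pt_yvec pairing_yvec => /(congr1 (fun p => p.[t _])) h i.
move: (h i); rewrite hornerD hornerZ hornerM Phi_horner !mulr0 addr0 horner0.
rewrite horner_sum (bigD1 i) //= big1 ?addr0 => [|j ji]; last first.
  by rewrite hornerM cof_horner0 // mulr0.
move/eqP; rewrite hornerM mulf_eq0 (negbTE (cof_horner i)) orbF => /eqP.
by rewrite hornerD !hornerZ.
Qed.

Lemma m_neq0 : m%:R != 0 :> K.
Proof. by rewrite pnatr_eq0. Qed.

Lemma lattice_pt_eq0 y : pairing y = 0 -> lattice_pt y = 0 -> y = 0.
Proof.
rewrite -(yvecK y) lattice_pt_yvec pairing_yvec.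
move: (ycoord A y) (ycoord B y) (ycoord c y) => al be ga h [d0 g0]; move: h.
rewrite d0 g0 big1 => [|i _]; last by rewrite !scaler0 add0r mul0r.
rewrite add0r => /eqP; rewrite scaler_eq0 (negbTE m_neq0) mulf_eq0 (negbTE Phi_neq0) orbF.
move=> /eqP b0; move: d0; rewrite b0 mulr0 subr0 => ->.
by apply/rowP => k; rewrite !mxE !scaler0 !addr0.
Qed.

Lemma size_ycoord n v y : (forall k, (size (y 0%R k) <= n)%N) -> (size (ycoord v y) <= n)%N.
Proof.
move=> h; rewrite (leq_trans (size_sum _ _ _)) //; apply/bigmax_leqP => k _.
by rewrite (leq_trans (size_scale_leq _ _)).
Qed.

Lemma lattice_pt_le n y : (forall k, (size (y 0%R k) <= n)%N) -> pairing y = 0 ->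
  lattice_le n (lattice_pt y).
Proof.
move=> h y0; split; [exact: pairing_lattice| |exact: size_ycoord].
rewrite (leq_trans (size_polyD _ _)) // size_polyN geq_max.
rewrite (leq_trans (size_ycoord A h)) //=.
by rewrite (leq_trans (size_polyMleq _ _)) // size_polyX add2n ltnS size_ycoord.
Qed.

Lemma size_yvec n (al be ga : {poly K}) k : (size al <= n)%N -> (size be <= n)%N ->
  (size ga <= n)%N -> (size (yvec al be ga 0%R k) <= n)%N.
Proof.
move=> sa sb sg; rewrite mxE (leq_trans (size_polyD _ _)) // geq_max.
rewrite (leq_trans (size_polyD _ _)) ?geq_max;
by rewrite ?(leq_trans (size_scale_leq _ _) sa)
  ?(leq_trans (size_scale_leq _ _) sb) ?(leq_trans (size_scale_leq _ _) sg).
Qed.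

(* Each lam_i delta + mu_i gamma is divisible by lin_i; minus the average of
   the quotients is the missing coordinate beta, and its leading coefficient
   is such that alpha = delta + X beta has no term of degree n. *)
Lemma lattice_pt_onto n x : lattice_le n x ->
  exists y, [/\ forall k, (size (y 0%R k) <= n)%N, pairing y = 0 & lattice_pt y = x].
Proof.
case: n => [|n] hx.
  rewrite (lattice_le0 za_neq0 hx); exists 0; split=> [k||].
  - by rewrite mxE size_poly0.
  - by rewrite /pairing big1 // => k _; rewrite mxE mul0r.
  have y0 v : ycoord v 0 = 0 by rewrite /ycoord big1 // => k _; rewrite mxE scaler0.
  by rewrite /lattice_pt !y0 mulr0 subr0.
case: x hx => de ga [/= hx sd sg].
pose s i := lam i *: de + mu i *: ga.
have ss i : (size (s i) <= n.+2)%N.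
  rewrite (leq_trans (size_polyD _ _)) // geq_max.
  by rewrite !(leq_trans (size_scale_leq _ _)) // (leq_trans sg).
pose r i := s i %/ lin i.
have lin0 i : lin i != 0 by rewrite linE scaler_eq0 negb_or za_neq0 polyXsubC_eq0.
have rE i : r i * lin i = s i.
  apply: divpK; rewrite linE dvdpZl ?za_neq0 // dvdp_XsubCl; apply/eqP.
  by rewrite hornerD !hornerZ; apply: hx.
have sl i : size (lin i) = 2 by rewrite linE size_scale ?size_XsubC ?za_neq0.
have sr i : (size (r i) <= n.+1)%N.
  by rewrite size_divp // sl /= leq_subLR add1n ss.
(* Only [de] reaches degree n + 1, so all quotients share this coefficient and their average keeps
   it. *)
have rn i : (r i)`_n = de`_n.+1.
  have := congr1 (fun p : {poly K} => p`_n.+1) (rE i).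
  rewrite coefD !coefZ [ga`__]nth_default // mulr0 addr0 linE -scalerAr coefZ.
  rewrite mulrBr coefB coefMX coefMC /= [(r i)`_n.+1]nth_default // mul0r subr0.
  by move/(mulfI (za_neq0 i)).
pose be := - (m%:R^-1 *: \sum_i r i).
have sb : (size be <= n.+1)%N.
  rewrite size_polyN (leq_trans (size_scale_leq _ _)) //.
  by rewrite (leq_trans (size_sum _ _ _)) //; apply/bigmax_leqP.
have bn : be`_n = - de`_n.+1.
  rewrite coefN coefZ coef_sum; congr (- _).
  under eq_bigr => i _ do rewrite rn.
  by rewrite sumr_const card_ord -[X in _ * X]mulr_natl mulKf // m_neq0.
have sa : (size (de + 'X * be)%R <= n.+1)%N.
  apply/leq_sizeP => j; rewrite leq_eqVlt => /predU1P [<-|nj].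
    by rewrite coefD coefXM /= bn subrr.
  rewrite coefD coefXM nth_default ?add0r; last exact: leq_trans nj.
  by case: j nj => // j nj; rewrite /= nth_default // (leq_trans sb).
exists (yvec (de + 'X * be) be ga); split=> [k||].
- exact: size_yvec.
- rewrite pairing_yvec addrK.
  have -> : \sum_i (lam i *: de + mu i *: ga) * cof i = (\sum_i r i) * Phi.
    rewrite mulr_suml; apply: eq_bigr => i _.
    by rewrite -/(s i) -rE -mulrA lin_cof.
  rewrite /be mulNr scalerN -scalerAl scalerA mulfV ?m_neq0 // scale1r.
  by rewrite subrr.
by rewrite lattice_pt_yvec addrK.
Qed.

(* The partial derivatives of the arrangement have no common zero on the line. *)
Lemma pairing_onto n p : (4 * d < n)%N -> (size p <= n)%N ->
  exists2 y : 'rV[{poly K}]_3, (forall k, (size (y 0%R k) <= n - d.*2)%N) & pairing y = p.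
Proof.
move=> dn sp; pose W := \sum_i lam i *: cof i.
have sW : (size W <= m)%N.
  rewrite (leq_trans (size_sum _ _ _)) //; apply/bigmax_leqP => i _.
  by rewrite (leq_trans (size_scale_leq _ _)) // size_cof.
have Wt i : W.[t i] != 0.
  rewrite horner_sum (bigD1 i) //= big1 ?addr0 => [|j ji].
    by rewrite hornerZ mulf_neq0 ?za_neq0 ?cof_horner.
  by rewrite hornerZ cof_horner0 // mulr0.
have /Bezout_eq1_coprimepP [[u v] /= uv] : coprimep W Phi.
  have [l l0 ->] := PhiE; rewrite coprimepZr // /node_poly.
  elim/big_rec: _ => [|i q _ cq]; first exact: coprimep1.
  by rewrite coprimepMr cq andbT coprimep_XsubC rootE Wt.
(* Reduction modulo [Phi] keeps the size of [de * W] at most 2m - 1 = 4d + 1, whence the bound on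
   [n]. What is left of [p] is a multiple of [Phi], absorbed by the Euler coordinate [be]. *)
pose de := (p * u) %% Phi.
have sde : (size de <= m)%N by rewrite -ltnS -size_Phi ltn_modp Phi_neq0.
have /dvdpP [q qE] : Phi %| p - de * W.
  have -> : p - de * W = (p * v + (p * u) %/ Phi * W) * Phi.
    have -> : de = p * u - (p * u) %/ Phi * Phi.
      by rewrite [in X in X - _](divp_eq (p * u) Phi) addrC addKr.
    by move: (_ %/ _) => q0; rewrite -{1}[p]mulr1 -uv; ring.
  exact: dvdp_mull.
have sq : (size q <= n - m)%N.
  have [->|q0] := eqVneq q 0; first by rewrite size_poly0.
  have : (size (p - de * W)%R <= n)%N.
    rewrite (leq_trans (size_polyD _ _)) // size_polyN geq_max sp /=.
    by rewrite (leq_trans (size_mul_le sde sW)) //; lia.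
  rewrite qE size_mul ?Phi_neq0 // size_Phi; plia.
pose be := m%:R^-1 *: q.
have sb : (size be <= n - m)%N by rewrite (leq_trans (size_scale_leq _ _)).
have sXb : (size ('X * be)%R <= n - d.*2)%N.
  have [->|b0] := eqVneq be 0; first by rewrite mulr0 size_poly0.
  rewrite mulrC size_mulX //; move: b0; rewrite -size_poly_gt0; plia.
exists (yvec (de + 'X * be) be 0) => [k|].
  apply: size_yvec; rewrite ?size_poly0 //; last by plia.
  by rewrite (leq_trans (size_polyD _ _)) // geq_max sXb andbT; plia.
rewrite pairing_yvec addrK.
under eq_bigr => i _ do rewrite scaler0 addr0 -scalerAl mulrC scalerAl -mulrC.
by rewrite -mulr_sumr -/W /be -scalerAl scalerA mulfV ?m_neq0 // scale1r -qE addrC subrK.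
Qed.

(* If theta_w lifts w and theta_p has pairing p with the derivatives, take
   jac theta_p *: theta_w - jac theta_w *: theta_p: it is in the kernel of jac,
   and its second term vanishes on the line. *)
Lemma lift_pscale n s w p : (4 * d < s)%N -> lattice_le n.+1 w -> (size p <= s)%N ->
  exists theta, [/\ forall k, theta 0 k \is (s + n).-1.-homog, jac theta = 0
    & lattice_pt (map_mx rho theta) = pscale p w].
Proof.
move=> ds /lattice_pt_onto [yw [sw yw0 <-]] sp.
have [yp syp ypE] := pairing_onto ds sp.
have jacE theta : rho (jac theta) = pairing (map_mx rho theta).
  by rewrite rmorph_sum; apply: eq_bigr => k _; rewrite rmorphM mxE.
pose tw : 'rV[R]_3 := \row_k homz A B n (yw 0 k).
pose tp : 'rV[R]_3 := \row_k homz A B (s - d.*2).-1 (yp 0 k).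
have htw k : tw 0 k \is n.-homog by rewrite mxE homz_homog.
have htp k : tp 0 k \is (s - d.*2).-1.-homog by rewrite mxE homz_homog.
have rw : map_mx rho tw = yw by apply/rowP => k; rewrite !mxE (restr_homz frame).
have rp : map_mx rho tp = yp.
  by apply/rowP => k; rewrite !mxE (restr_homz frame) // (leq_trans (syp k)) //; lia.
exists (jac tp *: tw - jac tw *: tp); split.
- move=> k; have -> : (jac tp *: tw - jac tw *: tp) 0 k =
      jac tp * tw 0 k - jac tw * tp 0 k by rewrite !mxE.
  rewrite rpredB //.
    have := dhomogM (jac_homog htp) (htw k).
    by have -> : ((s - d.*2).-1 + d.*2 + n = (s + n).-1)%N by lia.
  have := dhomogM (jac_homog htw) (htp k).
  by have -> : (n + d.*2 + (s - d.*2).-1 = (s + n).-1)%N by lia.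
- by rewrite jacB !jacZ mulrC subrr.
have -> : map_mx rho (jac tp *: tw - jac tw *: tp) = p *: yw.
  apply/rowP => k; rewrite !mxE rmorphB !rmorphM /= !jacE rw rp yw0 ypE.
  by rewrite mul0r subr0 -[in RHS]rw !mxE.
have yc v : ycoord v (p *: yw) = p * ycoord v yw.
  by rewrite /ycoord mulr_sumr; apply: eq_bigr => k _; rewrite mxE scalerAr.
by rewrite /lattice_pt /pscale !yc mulrBr mulrCA.
Qed.

End Frame.
End Arrangement.

(** * The graded module of derivations and its image in the lattice *)

Section RestrictedBundle.
Variable K : numFieldType.
Local Notation R := {mpoly K[3]}.
Variables (d : nat) (z : 'I_(d.+1 + d) -> 'rV[K]_3).
Local Notation m := (d.+1 + d)%N.
Variables a b e A B c : 'rV[K]_3.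
Hypothesis frame : dual_bases a b e A B c.
Hypothesis za_neq0 : forall i, dot (z i) a != 0.
Local Notation rho := (restr a b).
Local Notation lam := (fun i => dot (z i) a).
Local Notation mu := (fun i => dot (z i) e).
Local Notation t := (fun i => - dot (z i) b / dot (z i) a).
Hypothesis t_inj : injective t.
Local Notation lattice_le := (lattice_le lam mu t).
Implicit Types (theta eta : 'rV[R]_3).

Definition derivation_part j theta : Prop :=
  (forall k, theta 0 k \is j.-homog) /\ jac z theta = 0.

Definition to_lattice theta := lattice_pt A B c (map_mx rho theta).

Lemma to_latticeD theta eta :
  to_lattice (theta + eta) = to_lattice theta + to_lattice eta.
Proof.
have yc v : ycoord v (map_mx rho (theta + eta)) =
    ycoord v (map_mx rho theta) + ycoord v (map_mx rho eta).
  by rewrite -big_split; apply: eq_bigr => k _; rewrite !mxE rmorphD scalerDr.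
by rewrite /to_lattice /lattice_pt !yc mulrDr opprD addrACA.
Qed.

Lemma to_latticeZ g theta :
  to_lattice (g *: theta) = pscale (rho g) (to_lattice theta).
Proof.
have yc v : ycoord v (map_mx rho (g *: theta)) = rho g * ycoord v (map_mx rho theta).
  by rewrite mulr_sumr; apply: eq_bigr => k _; rewrite !mxE rmorphM scalerAr.
by rewrite /to_lattice /lattice_pt /pscale !yc mulrBr mulrCA.
Qed.

Lemma derivation_partD j theta eta : derivation_part j theta ->
  derivation_part j eta -> derivation_part j (theta + eta).
Proof.
move=> [h1 h2] [h3 h4]; split; last by rewrite jacD h2 h4 addr0.
by move=> k; rewrite mxE rpredD.
Qed.

Lemma derivation_partZ j k g theta : g \is k.-homog -> derivation_part j theta ->
  derivation_part (k + j) (g *: theta).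
Proof.
move=> hg [h1 h2]; split; last by rewrite jacZ h2 mulr0.
by move=> i; rewrite mxE dhomogM.
Qed.

Lemma restr_jac theta : rho (jac z theta) = pairing z a b (map_mx rho theta).
Proof. by rewrite rmorph_sum; apply: eq_bigr => k _; rewrite rmorphM mxE. Qed.

Lemma to_lattice_le j theta : derivation_part j theta ->
  lattice_le j.+1 (to_lattice theta).
Proof.
move=> [h1 h2]; apply: (lattice_pt_le frame za_neq0 t_inj).
  by move=> k; rewrite mxE; apply: size_restr.
by rewrite -restr_jac h2 rmorph0.
Qed.

Lemma lform_c_neq0 : lform c != 0.
Proof.
rewrite lform_eq0; have [_ _ [_ _ ce] _] := frame.
by apply: (@row3_neq0 _ _ e); rewrite ce oner_neq0.
Qed.

(** The Euler coordinate vanishes along with the lattice point, so all entries are divisible by [c];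
    the quotient stays in the kernel of [jac] because [c] is not a zero divisor. *)
Lemma to_lattice_eq0 j theta : derivation_part j.+1 theta -> to_lattice theta = 0 ->
  exists2 eta, derivation_part j eta & theta = lform c *: eta.
Proof.
move=> [h1 h2] th0; have r0 : map_mx rho theta = 0.
  by apply: (lattice_pt_eq0 frame za_neq0 _ th0); rewrite -restr_jac h2 rmorph0.
have H k : exists h, h \is j.-homog /\ theta 0 k = lform c * h.
  have [|h hh hE] := restr_eq0 frame (h1 k); last by exists h.
  by move/rowP/(_ k): r0; rewrite !mxE.
have [f fP] := choice H; exists (\row_k f k).
  split; first by move=> k; rewrite mxE; case: (fP k).
  apply: (mulfI lform_c_neq0); rewrite -jacZ mulr0 -[RHS]h2; congr (jac z _).
  by apply/rowP => k; rewrite !mxE; case: (fP k).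
by apply/rowP => k; rewrite !mxE; case: (fP k).
Qed.

(** Each term of the decomposition in a primitive basis is lifted by [lift_pscale], which needs room
    for coefficients of size above 4d; the degree bound is a generous way to provide it. *)
Lemma to_lattice_onto : exists N, forall j, (N <= j)%N -> forall x,
  lattice_le j.+1 x -> exists2 theta, derivation_part j theta & to_lattice theta = x.
Proof.
have [n0 [w [v [n0d w0 wv]]]] := exists_primitive_basis mu za_neq0 t_inj.
have [hw w_min hv _] := wv; have n0_gt0 := minimal_gt0 za_neq0 hw w0.
exists (10 * d + 10)%N => j Nj x hx.
have [p [q [xE sp sq]]] := primitive_basis_decomp za_neq0 t_inj n0d w0 wv hx.
have hw' : lattice_le n0.-1.+1 w by rewrite prednK.
have hv' : lattice_le (m - n0).+1 v by rewrite -subSn //; lia.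
have [|th1 [h1 j1 E1]] := lift_pscale frame za_neq0 t_inj _ hw' sp; first lia.
have [|th2 [h2 j2 E2]] := lift_pscale frame za_neq0 t_inj _ hv' sq; first lia.
exists (th1 + th2).
  apply: derivation_partD.
    by split=> // k; have := h1 k; have -> : (j.+2 - n0 + n0.-1).-1 = j by lia.
  by split=> // k; have := h2 k; have -> : (j.+1 + n0 - m + (m - n0)).-1 = j by lia.
by rewrite to_latticeD /to_lattice E1 E2.
Qed.

(** The map in [splits_on_line] is the same for all degrees, so [split_map] has to read the degree
    off its argument. *)
Definition top_degree theta := \max_k (msize (theta 0%R k)).-1.

Lemma top_degreeE j theta : theta != 0 -> (forall k, theta 0 k \is j.-homog) ->
  top_degree theta = j.
Proof.
move=> /rV0Pn [k k0] h.
have hk i : theta 0 i != 0 -> (msize (theta 0 i)).-1 = j.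
  by move=> i0; apply: (dhomog_uniq i0 _ (h i)); apply: dhomog_msize (h i).
apply/eqP; rewrite eqn_leq; apply/andP; split.
  apply/bigmax_leqP => i _; have [->|/hk ->//] := eqVneq (theta 0 i) 0.
  by rewrite msize0.
by rewrite -{1}(hk _ k0) (leq_bigmax_cond k).
Qed.

Section Basis.
Variables (n0 : nat) (w v : {poly K} * {poly K}).
Hypotheses (n0d : (n0 <= d.+1)%N) (w_neq0 : w != 0).
Hypothesis wv : primitive_basis lam mu t n0 w v.

Definition split_map theta : R * R :=
  (homz A B ((top_degree theta).+1 - n0) (coord1 w v (to_lattice theta)),
   homz A B (top_degree theta + n0 - m) (coord2 w v (to_lattice theta))).

Lemma split_mapP j theta : (m <= j)%N -> derivation_part j theta ->
  [/\ (split_map theta).1 \is (j.+1 - n0).-homog,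
      (split_map theta).2 \is (j + n0 - m).-homog,
      rho (split_map theta).1 = coord1 w v (to_lattice theta)
    & rho (split_map theta).2 = coord2 w v (to_lattice theta)].
Proof.
move=> mj hth; have [hw _ _ _] := wv; have n0_gt0 := minimal_gt0 za_neq0 hw w_neq0.
have [th0|th0] := eqVneq theta 0.
  have s0 : to_lattice theta = 0.
    have -> : theta = 0 *: theta by rewrite th0 scaler0.
    by rewrite to_latticeZ rmorph0 /pscale !mul0r.
  have [c1 c2] := coord0 w v.
  by rewrite /split_map s0 c1 c2 !homz0 !rmorph0 !rpred0.
have [_ s1 s2] := coord_lattice za_neq0 t_inj n0d w_neq0 wv (to_lattice_le hth).
rewrite /split_map (top_degreeE th0 (proj1 hth)) !homz_homog.
by rewrite !(restr_homz frame) //; plia.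
Qed.

Lemma split_mapD j theta eta : (m <= j)%N -> derivation_part j theta ->
  derivation_part j eta ->
  rho (split_map (theta + eta)).1 = rho ((split_map theta).1 + (split_map eta).1) /\
  rho (split_map (theta + eta)).2 = rho ((split_map theta).2 + (split_map eta).2).
Proof.
move=> mj hth het; rewrite !rmorphD /=.
have [_ _ -> ->] := split_mapP mj hth; have [_ _ -> ->] := split_mapP mj het.
have [_ _ -> ->] := split_mapP mj (derivation_partD hth het).
rewrite to_latticeD; apply: (coordD za_neq0 t_inj n0d w_neq0 wv (n := j.+1));
exact: to_lattice_le.
Qed.

Lemma split_mapZ j k g theta : (m <= j)%N -> g \is k.-homog ->
  derivation_part j theta ->
  rho (split_map (g *: theta)).1 = rho (g * (split_map theta).1) /\
  rho (split_map (g *: theta)).2 = rho (g * (split_map theta).2).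
Proof.
move=> mj hg hth; rewrite !rmorphM /=; have [_ _ -> ->] := split_mapP mj hth.
have mkj : (m <= k + j)%N by rewrite (leq_trans mj) // leq_addl.
have [_ _ -> ->] := split_mapP mkj (derivation_partZ hg hth).
rewrite to_latticeZ; apply: (coordZ za_neq0 t_inj n0d w_neq0 wv (n := j.+1)).
exact: to_lattice_le.
Qed.

Lemma split_map_eq0 j theta : (m <= j)%N -> derivation_part j theta ->
  (rho (split_map theta).1 = 0 /\ rho (split_map theta).2 = 0) <->
  to_lattice theta = 0.
Proof.
move=> mj hth; have [_ _ -> ->] := split_mapP mj hth; split=> [[c1 c2]|->].
  have [-> _ _] := coord_lattice za_neq0 t_inj n0d w_neq0 wv (to_lattice_le hth).
  by rewrite c1 c2 /pscale !mul0r addr0.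
exact: coord0.
Qed.

Lemma split_map_onto : exists N, forall j, (N <= j)%N -> forall u1 u2,
  u1 \is (j.+1 - n0).-homog -> u2 \is (j + n0 - m).-homog ->
  exists2 theta, derivation_part j theta &
    rho (split_map theta).1 = rho u1 /\ rho (split_map theta).2 = rho u2.
Proof.
have [N onto] := to_lattice_onto; exists (maxn N (10 * d + 10)) => j.
rewrite geq_max => /andP [Nj dj] u1 u2 hu1 hu2.
have [[hw w1 w2] _ [hv v1 v2] _] := wv.
have [hw' _ _ _] := wv; have n0_gt0 := minimal_gt0 za_neq0 hw' w_neq0.
have s1 := size_restr a b hu1; have s2 := size_restr a b hu2.
have hx : lattice_le j.+1 (pscale (rho u1) w + pscale (rho u2) v).
  split.
  - by apply: in_latticeD; apply: in_lattice_scale.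
  - rewrite (leq_trans (size_polyD _ _)) // geq_max.
    rewrite (leq_trans (size_mul_le s1 w1)) ?(leq_trans (size_mul_le s2 v1)) //; lia.
  rewrite (leq_trans (size_polyD _ _)) // geq_max.
  rewrite (leq_trans (size_mul_le s1 w2)) ?(leq_trans (size_mul_le s2 v2)) //; lia.
have [theta hth thE] := onto j Nj _ hx; exists theta => //.
have mj : (m <= j)%N by lia.
by have [_ _ -> ->] := split_mapP mj hth; rewrite thE; exact: coord_uniq wv _ _.
Qed.

End Basis.

End RestrictedBundle.

(** * Splittings on a line *)

Section Splitting.
Variables (T : realType) (d : nat).
Local Notation C := (T[i]).
Local Notation R := (ring3 T).
Variable z : 'I_(d.+1 + d) -> 'rV[C]_3.
Local Notation m := (d.+1 + d)%N.
Variables a b e A B c : 'rV[C]_3.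
Hypothesis frame : dual_bases a b e A B c.
Hypothesis za_neq0 : forall i, dot (z i) a != 0.
Local Notation rho := (restr a b).
Local Notation lam := (fun i => dot (z i) a).
Local Notation mu := (fun i => dot (z i) e).
Local Notation t := (fun i => - dot (z i) b / dot (z i) a).
Hypothesis t_inj : injective t.
Local Notation lattice_le := (lattice_le lam mu t).
Local Notation V := ({poly C} * {poly C})%type.
Local Notation S_eq := (eqmod (ideal_gen (fun _ : 'I_1 => dual_form c))).
Local Notation sigma := (to_lattice a b A B c).
Local Notation M := (derivation_bundle z).
Implicit Types (theta eta : 'rV[R]_3) (g h : R).

Lemma S_eq_restr g h : S_eq g h -> rho g = rho h.
Proof.
move=> [q /(congr1 rho)]; rewrite big_ord1 rmorphB rmorphM /=.
rewrite (_ : rho (dual_form c) = 0) ?mulr0; last exact: restr_c frame.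
by move/eqP; rewrite subr_eq0 => /eqP.
Qed.

Lemma restr_S_eq n g h : g \is n.-homog -> h \is n.-homog -> rho g = rho h ->
  S_eq g h.
Proof.
move=> hg hh E; have gh : g - h \is n.-homog by rewrite rpredB.
have E0 : rho (g - h) = 0 by rewrite rmorphB /= E subrr.
case: n gh {hg hh} => [|n] gh.
  by exists (fun=> 0); rewrite big_ord1 mul0r (restr_eq00 frame gh).
have [eta _ ghE] := restr_eq0 frame gh E0.
by exists (fun=> eta); rewrite big_ord1 mulrC; exact: ghE.
Qed.

Section Basis.
Variables (n0 : nat) (w v : V).
Hypotheses (n0d : (n0 <= d.+1)%N) (w_neq0 : w != 0).
Hypothesis wv : primitive_basis lam mu t n0 w v.

(** The twists are the negatives of the degrees n0 - 1 and m - n0 of the basis. *)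
Lemma splits_primitive_basis :
  splits_on_line M (dual_form c) (1 - n0%:Z) (n0%:Z - m%:Z).
Proof.
have [N onto] := split_map_onto frame za_neq0 t_inj n0d w_neq0 wv.
pose N' := maxn N (10 * d + 10); exists N'%:Z, (split_map d a b A B c n0 w v) => -[j|//].
rewrite lez_nat geq_max => /andP [Nj dj].
have mj : (m <= j)%N by clear -dj; lia.
have [hw _ _ _] := wv; have n0_gt0 := minimal_gt0 za_neq0 hw w_neq0.
have E1 : j%:Z + (1 - n0%:Z) = (j.+1 - n0)%:Z by clear -n0d n0_gt0 dj; lia.
have E2 : j%:Z + (n0%:Z - m%:Z) = (j + n0 - m)%:Z by clear -n0d n0_gt0 mj; lia.
have mapP := split_mapP frame za_neq0 t_inj n0d w_neq0 wv.
rewrite E1 E2; split.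
- by move=> theta /(mapP _ _ mj) [].
- move=> theta eta hth het.
  have [h1 h2 _ _] := mapP _ _ mj hth; have [h3 h4 _ _] := mapP _ _ mj het.
  have [h5 h6 _ _] := mapP _ _ mj (derivation_partD hth het).
  have [r1 r2] := split_mapD frame za_neq0 t_inj n0d w_neq0 wv mj hth het.
  by split; [apply: restr_S_eq h5 (rpredD h1 h3) r1|
             apply: restr_S_eq h6 (rpredD h2 h4) r2].
- move=> k g theta hg hth; have [h1 h2 _ _] := mapP _ _ mj hth.
  have mkj : (m <= k + j)%N by rewrite (leq_trans mj) // leq_addl.
  have [h5 h6 _ _] := mapP _ _ mkj (derivation_partZ hg hth).
  have [r1 r2] := split_mapZ frame za_neq0 t_inj n0d w_neq0 wv mj hg hth.
  have h3 := dhomogM hg h1; have h4 := dhomogM hg h2.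
  have e1 : (k + (j.+1 - n0) = (k + j).+1 - n0)%N by clear -n0d mj; lia.
  have e2 : (k + (j + n0 - m) = k + j + n0 - m)%N by clear -mj; lia.
  rewrite e1 in h3; rewrite e2 in h4.
  by split; [apply: restr_S_eq h5 h3 r1|apply: restr_S_eq h6 h4 r2].
- move=> theta hth; have [h1 h2 _ _] := mapP _ _ mj hth.
  have th0 := split_map_eq0 frame za_neq0 t_inj n0d w_neq0 wv mj hth.
  have jE : j = j.-1.+1 by clear -mj; lia.
  have -> : j%:Z - 1 = j.-1%:Z by clear -mj; lia.
  split.
    move=> [/S_eq_restr + /S_eq_restr]; rewrite rmorph0 => c1 c2.
    have s0 : sigma theta = 0 by apply/th0.
    move: hth; rewrite {1}jE => hth.
    exact: (to_lattice_eq0 frame za_neq0 hth s0).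
  move=> [eta _ thE].
  have s0 : sigma theta = 0.
    rewrite thE to_latticeZ (_ : rho (lform c) = 0) ?(restr_c frame) //.
    by rewrite /pscale !mul0r.
  have [c1 c2] := proj2 th0 s0.
  split; [apply: restr_S_eq h1 (rpred0 _) _|apply: restr_S_eq h2 (rpred0 _) _].
    by rewrite c1 rmorph0.
  by rewrite c2 rmorph0.
move=> u1 u2 hu1 hu2; have [theta hth [r1 r2]] := onto j Nj _ _ hu1 hu2.
exists theta => //; have [h1 h2 _ _] := mapP _ _ mj hth.
by split; [apply: restr_S_eq h1 hu1 r1|apply: restr_S_eq h2 hu2 r2].
Qed.

End Basis.

End Splitting.

(** * Comparing an arbitrary splitting with the primitive basis *)

Section SplittingDegrees.
Variables (T : realType) (d : nat).
Local Notation C := (T[i]).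
Local Notation R := (ring3 T).
Variable z : 'I_(d.+1 + d) -> 'rV[C]_3.
Local Notation m := (d.+1 + d)%N.
Variables a b e A B c : 'rV[C]_3.
Hypothesis frame : dual_bases a b e A B c.
Hypothesis za_neq0 : forall i, dot (z i) a != 0.
Local Notation rho := (restr a b).
Local Notation lam := (fun i => dot (z i) a).
Local Notation mu := (fun i => dot (z i) e).
Local Notation t := (fun i => - dot (z i) b / dot (z i) a).
Hypothesis t_inj : injective t.
Local Notation lattice_le := (lattice_le lam mu t).
Local Notation V := ({poly C} * {poly C})%type.
Local Notation sigma := (to_lattice a b A B c).
Local Notation M := (derivation_bundle z).
Implicit Types (theta eta : 'rV[R]_3) (g h : R).

Section SplitMap.
Variables (N : nat) (psi : 'rV[R]_3 -> V).
Hypothesis psiD : forall j theta eta, (N <= j)%N -> derivation_part z j theta ->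
  derivation_part z j eta -> psi (theta + eta) = psi theta + psi eta.
Hypothesis psiZ : forall j k g theta, (N <= j)%N -> g \is k.-homog ->
  derivation_part z j theta -> psi (g *: theta) = pscale (rho g) (psi theta).
Hypothesis psi_eq0 : forall j theta, (N <= j)%N -> derivation_part z j theta ->
  psi theta = 0 -> sigma theta = 0.

Lemma split_map_inj j theta eta : (N <= j)%N -> derivation_part z j theta ->
  derivation_part z j eta -> psi theta = psi eta -> sigma theta = sigma eta.
Proof.
move=> Nj hth het E.
have h1 : (-1 : R) \is 0.-homog by rewrite rpredN dhomog1.
have hNeta : derivation_part z j (-1 *: eta) := derivation_partZ h1 het.
have rN1 : rho (-1) = -1 by rewrite rmorphN1.
have NE (x y : V) : x + pscale (-1) y = x - y by rewrite /pscale !mulN1r.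
have := psi_eq0 Nj (derivation_partD hth hNeta).
rewrite (psiD Nj hth hNeta) (psiZ Nj h1 het) to_latticeD to_latticeZ rN1 !NE E.
by rewrite subrr => /(_ erefl)/eqP; rewrite subr_eq0 => /eqP.
Qed.

(* The preimage of u in one of the two summands is u times a fixed element:
   comparing the preimages of A^n and B^n, multiplied by B^n and A^n, shows that
   the preimage of B^n has degree n less than expected. *)
Lemma split_summand j n (iota : {poly C} -> V) : (N <= j)%N ->
  (forall p q, iota (p * q) = pscale p (iota q)) ->
  (forall u : R, u \is n.-homog -> exists2 theta, derivation_part z j theta &
     psi theta = iota (rho u)) ->
  exists2 w, lattice_le (j.+1 - n) w & forall (u : R) theta, u \is n.-homog ->
    derivation_part z j theta -> psi theta = iota (rho u) ->
    sigma theta = pscale (rho u) w.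
Proof.
move=> Nj iotaM onto.
have hA : lform A ^+ n \is n.-homog by have := dhomogMn n (lform_homog A); rewrite mul1n.
have hB : lform B ^+ n \is n.-homog by have := dhomogMn n (lform_homog B); rewrite mul1n.
have rA : rho (lform A ^+ n) = 'X^n by rewrite rmorphXn /= (restr_A frame).
have rB : rho (lform B ^+ n) = 1 by rewrite rmorphXn /= (restr_B frame) expr1n.
have [thB hthB BE] := onto _ hB; have [thA hthA AE] := onto _ hA.
have Njn : (N <= n + j)%N by rewrite (leq_trans Nj) // leq_addl.
have key (u : R) theta : u \is n.-homog -> derivation_part z j theta ->
    psi theta = iota (rho u) -> sigma theta = pscale (rho u) (sigma thB).
  move=> hu hth E; have := split_map_inj Njn (derivation_partZ hB hth) (derivation_partZ hu hthB).
  rewrite (psiZ Nj hB hth) (psiZ Nj hu hthB) E BE -!iotaM rB mulr1 mul1r => /(_ erefl).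
  by rewrite !to_latticeZ rB /pscale !mul1r -surjective_pairing.
exists (sigma thB) => //; have [_ s1 s2] := to_lattice_le frame za_neq0 t_inj hthA.
have [hw _ _] := to_lattice_le frame za_neq0 t_inj hthB.
move: s1 s2; rewrite (key _ _ hA hthA AE) rA => s1 s2.
have shift (p : {poly C}) k : (size ('X^n * p)%R <= j.+1 + k)%N ->
    (size p <= j.+1 - n + k)%N.
  have [->|p0] := eqVneq p 0; first by rewrite size_poly0.
  by rewrite mulrC size_mulXn //; move: p0; rewrite -size_poly_gt0; plia.
split=> //; first by rewrite -[(_ - _).+1]addn1; apply: shift; rewrite addn1.
by rewrite -[X in (_ <= X)%N]addn0; apply: shift; rewrite addn0.
Qed.

End SplitMap.

(** The summands of the given splitting yield lattice elements [w1], [w2] with bounds j + 1 - na and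
    j + 1 - nb. Determinants show that these bounds add up to at most m + 1 = 2d + 2; by minimality
    each is at least [n0], and they differ by at least 2, so 2 n0 + 2 <= 2d + 2. *)
Lemma split_degree_bound n0 (w v : V) (a' b' : int) :
  (n0 <= d.+1)%N -> w != 0 -> primitive_basis lam mu t n0 w v ->
  splits_on_line M (dual_form c) a' b' -> 2 <= `|a' - b'| -> (n0 <= d)%N.
Proof.
move=> n0d w0 wv [N0 [psi0 split]] ab.
have [N1 onto] := to_lattice_onto frame za_neq0 t_inj.
have [hw w_min hv _] := wv; have n0_gt0 := minimal_gt0 za_neq0 hw w0.
pose psi theta : V := (rho (psi0 theta).1, rho (psi0 theta).2).
pose N := `|N0|%N.
have leN j : (N <= j)%N -> N0 <= j%:Z by rewrite /N; lia.
have psiD j theta eta : (N <= j)%N -> derivation_part z j theta ->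
    derivation_part z j eta -> psi (theta + eta) = psi theta + psi eta.
  move=> /leN /split [_ + _ _ _] hth het => /(_ _ _ hth het) [].
  move=> /(S_eq_restr frame) E1 /(S_eq_restr frame) E2.
  by rewrite /psi E1 E2 /= !rmorphD.
have psiZ j k g theta : (N <= j)%N -> g \is k.-homog ->
    derivation_part z j theta -> psi (g *: theta) = pscale (rho g) (psi theta).
  move=> /leN /split [_ _ + _ _] hg hth => /(_ _ _ _ hg hth) [].
  move=> /(S_eq_restr frame) E1 /(S_eq_restr frame) E2.
  by rewrite /psi E1 E2 /= !rmorphM.
have psi_eq0 j theta : (N <= j)%N -> derivation_part z j theta ->
    psi theta = 0 -> sigma theta = 0.
  move=> /leN /split [deg _ _ + _] hth => /(_ _ hth) h0 [E1 E2].
  have [d1 d2] := deg _ hth.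
  have S0 (k : int) (u : R) : degree_part k u -> rho u = 0 ->
      eqmod (ideal_gen (fun _ : 'I_1 => dual_form c)) u 0.
    case: k => [k|k] /= hu u0; last by apply: (restr_S_eq frame (n := 0)); rewrite ?hu ?rpred0.
    by apply: (restr_S_eq frame hu); rewrite ?rpred0 // rmorph0.
  have [eta _ ->] : exists2 eta, M (j%:Z - 1) eta & theta = dual_form c *: eta.
    by apply/h0; split; [apply: (S0 _ _ d1)|apply: (S0 _ _ d2)].
  rewrite to_latticeZ (_ : rho (dual_form c) = 0); last exact: restr_c frame.
  by rewrite /pscale !mul0r.
(* A single degree is enough, provided that both asymptotic statements hold in it, the twisted
   degrees are nonnegative and the basis fits. *)
pose j := (N + N1 + `|a'| + `|b'| + 10 * d + 10)%N.
have Nj : (N <= j)%N by rewrite /j; lia.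
have N1j : (N1 <= j)%N by rewrite /j; lia.
have [na naE] : exists na : nat, j%:Z + a' = na%:Z.
  by exists `|(j%:Z + a')%R|%N; rewrite /j; lia.
have [nb nbE] : exists nb : nat, j%:Z + b' = nb%:Z.
  by exists `|(j%:Z + b')%R|%N; rewrite /j; lia.
have [deg _ _ _ sur] := split _ (leN _ Nj).
rewrite naE nbE in deg sur.
have surj u1 u2 : u1 \is na.-homog -> u2 \is nb.-homog ->
    exists2 theta, derivation_part z j theta & psi theta = (rho u1, rho u2).
  move=> hu1 hu2; have [theta hth [E1 E2]] := sur _ _ hu1 hu2; exists theta => //.
  by rewrite /psi (S_eq_restr frame E1) (S_eq_restr frame E2).
have [|u hu|w1 hw1 w1E] := @split_summand N psi psiD psiZ psi_eq0 j na (fun p => (p, 0)) Nj.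
- by move=> p q; rewrite /pscale mulr0.
- by have := surj u 0 hu (rpred0 _); rewrite rmorph0.
have [|u hu|w2 hw2 w2E] := @split_summand N psi psiD psiZ psi_eq0 j nb (fun p => (0, p)) Nj.
- by move=> p q; rewrite /pscale mulr0.
- by have := surj 0 u (rpred0 _) hu; rewrite rmorph0.
have gen x : lattice_le j.+1 x -> exists p q, [/\ x = pscale p w1 + pscale q w2,
    (size p <= na.+1)%N & (size q <= nb.+1)%N].
  move=> /(onto _ N1j) [theta hth <-]; have [h1 h2] := deg _ hth.
  have [th1 hth1 E1] := surj _ 0 h1 (rpred0 _).
  have [th2 hth2 E2] := surj 0 _ (rpred0 _) h2.
  exists (rho (psi0 theta).1), (rho (psi0 theta).2); split; try exact: size_restr.
  rewrite -(w1E _ th1) //; last by rewrite E1 rmorph0.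
  rewrite -(w2E _ th2) //; last by rewrite E2 rmorph0.
  rewrite -to_latticeD; apply: (split_map_inj psiD psiZ psi_eq0 Nj) => //.
    exact: derivation_partD.
  by rewrite (psiD _ _ _ Nj) // E1 E2 rmorph0 /psi; congr pair; rewrite /= ?addr0 ?add0r.
have widen n x : lattice_le n x -> (n <= j.+1)%N -> lattice_le j.+1 x.
  by move=> [h0 h1 h2] nj; split=> //; [apply: leq_trans h1 _|apply: leq_trans h2 _].
have dj : (10 * d + 10 <= j)%N by rewrite /j; lia.
have mulX n x : lattice_le n x -> (n <= j.+1)%N ->
    lattice_le j.+1 (pscale 'X^(j.+1 - n) x).
  move=> [h0 h1 h2] nj; split; first exact: in_lattice_scale.
    by rewrite (leq_trans (size_mul_le (leqnn _) h1)) // size_polyXn; lia.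
  by rewrite (leq_trans (size_mul_le (leqnn _) h2)) // size_polyXn; lia.
have detE p1 q1 p2 q2 : pdet (pscale p2 w1 + pscale q2 w2) (pscale p1 w1 + pscale q1 w2) =
    (p2 * q1 - q2 * p1) * pdet w1 w2 by rewrite /pdet /=; ring.
have D_neq0 : pdet v w != 0 := pdet_basis_neq0 wv.
have sizeD : size (pdet v w) = m.+1 := size_pdet_basis wv.
have [p1 [q1 [wE _ _]]] := gen w (widen _ _ hw ltac:(lia)).
have [p2 [q2 [vE _ _]]] := gen v (widen _ _ hv ltac:(lia)).
(* Thus [pdet w1 w2] divides the determinant of the primitive basis and has size at most m + 1. *)
have DE := detE p1 q1 p2 q2; rewrite -wE -vE in DE.
have D12 : pdet w1 w2 != 0 by apply: contraNneq D_neq0 => D0; rewrite DE D0 mulr0.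
have c12 : p2 * q1 - q2 * p1 != 0.
  by apply: contraNneq D_neq0 => D0; rewrite DE D0 mul0r.
have sD12 : (size (pdet w1 w2) <= m.+1)%N.
  rewrite -sizeD DE size_mul //; move: c12; rewrite -size_poly_gt0; plia.
have nj0 : (n0 <= j.+1)%N by lia.
have nj1 : (m.+1 - n0 <= j.+1)%N by lia.
(* Shifted up to degree j, the basis has determinant of size 2j + 2; in terms of [w1] and [w2] the
   same determinant has size at most na + nb + 1 + m. *)
have [P1 [Q1 [WE sP1 sQ1]]] := gen _ (mulX _ _ hw nj0).
have [P2 [Q2 [VE sP2 sQ2]]] := gen _ (mulX _ _ hv nj1).
have := detE P1 Q1 P2 Q2; rewrite -WE -VE.
have -> : pdet (pscale 'X^(j.+1 - (m.+1 - n0)) v) (pscale 'X^(j.+1 - n0) w) =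
    pdet v w * 'X^(j.+1 - n0 + (j.+1 - (m.+1 - n0))).
  rewrite exprD /pdet /=; ring.
move=> E; have := congr1 (fun p : {poly C} => size p) E.
rewrite size_mulXn // sizeD => sE.
have : (size ((P2 * Q1 - Q2 * P1) * pdet w1 w2)%R <= na + nb + 1 + m)%N.
  have sPQ : (size (P2 * Q1 - Q2 * P1)%R <= na + nb + 1)%N.
    rewrite (leq_trans (size_polyD _ _)) // size_polyN geq_max.
    rewrite (leq_trans (size_mul_le sP2 sQ1)) ?(leq_trans (size_mul_le sQ2 sP1)) //; lia.
  by rewrite (leq_trans (size_mul_le sPQ sD12)) //; lia.
rewrite -sE => bound.
have w1_neq0 : w1 != 0.
  by apply: contraNneq D12 => ->; rewrite /pdet /= !mul0r subrr.
have w2_neq0 : w2 != 0.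
  by apply: contraNneq D12 => ->; rewrite /pdet /= !mulr0 subrr.
have le1 : (n0 <= j.+1 - na)%N.
  by rewrite leqNgt; apply: contra w1_neq0 => lt; rewrite (w_min _ _ lt hw1).
have le2 : (n0 <= j.+1 - nb)%N.
  by rewrite leqNgt; apply: contra w2_neq0 => lt; rewrite (w_min _ _ lt hw2).
have [H|H] : (na + 2 <= nb)%N \/ (nb + 2 <= na)%N by clear -ab naE nbE; lia.
  by clear -bound le1 le2 nj0 nj1 n0d n0_gt0 H; lia.
by clear -bound le1 le2 nj0 nj1 n0d n0_gt0 H; lia.
Qed.

End SplittingDegrees.

(** * General lines and the equivalence *)

Section GenericLine.
Variables (K : numFieldType) (d : nat) (z : 'I_(d.+1 + d) -> 'rV[K]_3).
Local Notation m := (d.+1 + d)%N.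
Hypothesis z_neq0 : forall i, z i != 0.
Hypothesis z_distinct : forall i j, i != j -> cross (z i) (z j) != 0.

Lemma prod_homog (I : Type) (r : seq I) (P : pred I) (F : I -> {mpoly K[3]}) :
  (forall i, exists e, F i \is e.-homog) ->
  exists e, \prod_(i <- r | P i) F i \is e.-homog.
Proof.
move=> h; elim/big_rec: _ => [|i x _ [e hx]]; first by exists 0%N; apply: dhomog1.
by have [e' hi] := h i; exists (e' + e)%N; apply: dhomogM.
Qed.

(* A line is general when it passes through no intersection point of two lines
   of the arrangement and is not one of these lines. *)
Lemma exists_generic_frames : exists (n : nat) (F : {mpoly K[3]}),
  [/\ F != 0, F \is n.-homog & forall c : 'rV[K]_3, F.@[fun k => c 0 k] != 0 ->
    exists a b e A B, [/\ dual_bases a b e A B c, forall i, dot (z i) a != 0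
      & injective (fun i => - dot (z i) b / dot (z i) a)]].
Proof.
have H i : exists y, y != 0 /\ dot (z i) y = 0.
  by have [y] := exists_orthogonal (z i); exists y.
have [y yP] := choice H.
pose F := \prod_i lform (y i) *
  \prod_i \prod_(j < m | j != i) lform (cross (z i) (z j)).
have [e1 h1] : exists e, \prod_i lform (y i) \is e.-homog.
  by apply: prod_homog => i; exists 1%N; apply: lform_homog.
have [e2 h2] : exists e,
    \prod_i \prod_(j < m | j != i) lform (cross (z i) (z j)) \is e.-homog.
  by apply: prod_homog => i; apply: prod_homog => j; exists 1%N; apply: lform_homog.
exists (e1 + e2)%N, F; split; [|exact: dhomogM|].
  rewrite mulf_neq0 //; apply/prodf_neq0 => i _.
    by rewrite lform_eq0; case: (yP i).
  by apply/prodf_neq0 => j ji; rewrite lform_eq0 z_distinct // eq_sym.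
move=> c; rewrite mevalM mulf_eq0 negb_or => /andP [].
rewrite !rmorph_prod /= => /prodf_neq0 c1 /prodf_neq0 c2.
have cy i : dot (y i) c != 0 by rewrite -meval_lform; apply: c1.
have cz i j : j != i -> dot (cross (z i) (z j)) c != 0.
  move=> ji; rewrite -meval_lform; have := c2 i isT; rewrite rmorph_prod /=.
  by move/prodf_neq0/(_ j ji).
have c0 : c != 0 by apply: (@row3_neq0 _ _ (y (lshift d ord0))); rewrite dotC.
have zc i : cross (z i) c != 0.
  apply: contra (cy i) => /eqP h; have [_ zy] := yP i.
  by rewrite dotC (cross_eq0_dot h).
(* The point [a] is sought as c x u, on the line by construction; it avoids the [i]-th line when
   (z_i x c).u is nonzero, which holds for general u. *)
have : \prod_i lform (cross (z i) c) != 0.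
  by apply/prodf_neq0 => i _; rewrite lform_eq0.
move/exists_meval_neq0 => [u']; pose u : 'rV[K]_3 := \row_k u' k.
rewrite (meval_eq _ (v2 := fun k => u 0 k)); last by move=> k; rewrite mxE.
rewrite rmorph_prod /= => /prodf_neq0 uP; pose a := cross c u.
have za i : dot (z i) a != 0 by rewrite -dot_cross -meval_lform; apply: uP.
have a0 : a != 0 by apply: (@row3_neq0 _ _ (z (lshift d ord0))); rewrite dotC.
have ca : dot c a = 0 by rewrite dotC dot_crossl.
have [b [e [A [B [abc frame]]]]] := exists_dual_bases a0 c0 ca.
exists a, b, e, A, B; split=> // i j /= E; apply/eqP; apply: contraT => ij.
(* With a x b = c, equality of two parameters says exactly that the intersection point z_i x z_j
   lies on the line [c]. *)
have := cz i j; rewrite eq_sym => /(_ ij); rewrite -abc -dot_crossx.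
have /eqP : - dot (z i) b * dot (z j) a = - dot (z j) b * dot (z i) a.
  by apply/eqP; rewrite -eqr_div ?za //; apply/eqP.
by rewrite !mulNr eqr_opp => /eqP ->; rewrite mulrC subrr eqxx.
Qed.

(** The generators have degree d: projected to degree n, the combination vanishes if n < d and has
    constant coefficients if n = d. *)
Lemma ideal_power_comb n (g : {mpoly K[3]}) (q : 'I_m -> {mpoly K[3]}) :
  g \is n.-homog -> g = \sum_i q i * lform (z i) ^+ d ->
  ((n < d)%N -> g = 0) /\ (n = d -> exists x, g = power_comb z x).
Proof.
move=> hg gE; have hl i : lform (z i) ^+ d \is d.-homog.
  by have := dhomogMn d (lform_homog (z i)); rewrite mul1n.
have gp : g = pihomog mdeg n g by rewrite pihomog_dE.
split=> nd.
  by rewrite gp gE raddf_sum big1 // => i _; apply: pihomog_mul_lt (hl i) nd.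
exists (\col_i (pihomog mdeg 0 (q i))@_0); rewrite gp gE raddf_sum.
apply: eq_bigr => i _; rewrite mxE /= nd -[X in pihomog _ X]add0n.
rewrite (pihomog_mul _ _ (hl i)) [X in X * _]dhomog0_const ?mul_mpolyC //.
exact: pihomogP.
Qed.

Lemma power_comb0 : power_comb z 0 = 0.
Proof. by rewrite /power_comb big1 // => i _; rewrite mxE scale0r. Qed.

Lemma square_mul_eq0 (c : 'rV[K]_3) g : c != 0 -> lform c ^+ 2 * g = 0 -> g = 0.
Proof.
move=> c0 /eqP; rewrite mulf_eq0 expf_eq0 /= lform_eq0 (negbTE c0) => /eqP.
by [].
Qed.

End GenericLine.

(** * Failure of maximal rank and the two implications *)

Section MainProof.
Variables (T : realType) (d : nat).
Local Notation C := (T[i]).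
Variable z : 'I_(d.+1 + d) -> 'rV[C]_3.
Local Notation m := (d.+1 + d)%N.
Hypothesis z_neq0 : forall i, z i != 0.
Hypothesis z_distinct : forall i j, i != j -> cross (z i) (z j) != 0.
Hypothesis z_indep : forall x, power_comb z x = 0 -> x = 0.
Local Notation J := (ideal_gen (fun i => dual_form (z i) ^+ d)).

Lemma ideal_power n g : g \is n.-homog -> J g ->
  ((n < d)%N -> g = 0) /\ (n = d -> exists x, g = power_comb z x).
Proof. by move=> hg [q gE]; apply: ideal_power_comb hg gE. Qed.

Lemma power_comb_ideal x : J (power_comb z x).
Proof.
by exists (fun i => (x i 0)%:MP); apply: eq_bigr => i _; rewrite mul_mpolyC.
Qed.

Lemma ideal0 : J 0.
Proof. by exists (fun=> 0); rewrite big1 // => i _; rewrite mul0r. Qed.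

(** For d < 2 the source lies in negative degree and is zero, so failure of injectivity forces 1 <
    d. Then two forms with the same image differ by some g with c^2 g in degree d of the ideal,
    hence a combination of the powers. *)
Lemma not_injective_square (c : 'rV[C]_3) : c != 0 ->
  ~ mult_injective J (dual_form c ^+ 2) (d%:Z - 2) ->
  (1 < d)%N /\ exists x, x != 0 /\ exists g,
    g \is (d - 2).-homog /\ power_comb z x = lform c ^+ 2 * g.
Proof.
move=> c0 ninj; have d2 : (1 < d)%N.
  rewrite ltnNge; apply/negP => d1; apply: ninj => g h.
  have -> : d%:Z - 2 = Negz (1 - d) by lia.
  by move=> /= -> -> _; rewrite /eqmod subrr; apply: ideal0.
split=> //; apply: contrapT => nex; apply: ninj => g h.
have -> : d%:Z - 2 = (d - 2)%:Z by lia.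
move=> /= hg hh; rewrite /eqmod => Jgh.
have hgh : g - h \is (d - 2).-homog by rewrite rpredB.
have hL : lform c ^+ 2 * (g - h) \is d.-homog.
  have := dhomogM (dhomogMn 2 (lform_homog c)) hgh.
  by have -> : (1 * 2 + (d - 2) = d)%N by lia.
have JL : J (lform c ^+ 2 * (g - h)) by rewrite mulrBr; exact: Jgh.
have [_ /(_ erefl) [x xE]] := ideal_power hL JL.
have [x0|x0] := eqVneq x 0; last first.
  by case: nex; exists x; split=> //; exists (g - h).
rewrite x0 power_comb0 in xE; rewrite (square_mul_eq0 c0 xE).
exact: ideal0.
Qed.

(** The ideal is zero in degree d - 2, so a nonzero g stays nonzero in the quotient. *)
Lemma mult_square_fails g (x : 'cV[C]_m) L : (1 < d)%N -> g \is (d - 2).-homog ->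
  g != 0 -> L ^+ 2 * g = power_comb z x -> ~ mult_injective J (L ^+ 2) (d%:Z - 2).
Proof.
move=> d2 hg g0 E inj; have dE : d%:Z - 2 = (d - 2)%:Z by lia.
rewrite dE in inj.
have : eqmod J g 0.
  apply: (inj g 0 hg (rpred0 _)); rewrite /eqmod mulr0 subr0 E.
  exact: power_comb_ideal.
rewrite /eqmod subr0 => Jg; have [/(_ ltac:(lia)) g00 _] := ideal_power hg Jg.
by move/eqP: g0.
Qed.

Lemma not_surjective_square h L : (1 < d)%N -> L \is 1.-homog -> h \is d.-homog ->
  (forall x g, h <> power_comb z x + L ^+ 2 * g) ->
  ~ mult_surjective J (L ^+ 2) (d%:Z - 2) 2.
Proof.
move=> d2 hL hh hP sur; have dE : d%:Z - 2 = (d - 2)%:Z by lia.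
have dE' : d%:Z - 2 + 2%:Z = d%:Z by lia.
move: sur; rewrite /mult_surjective dE' dE => /(_ h hh) [g hg].
rewrite /eqmod => Jgh.
have hgh : L ^+ 2 * g - h \is d.-homog.
  rewrite rpredB //; have := dhomogM (dhomogMn 2 hL) hg.
  by have -> : (1 * 2 + (d - 2) = d)%N by lia.
have [_ /(_ erefl) [x xE]] := ideal_power hgh Jgh.
apply: (hP (- x) g); rewrite -[LHS](subKr (L ^+ 2 * g)) xE addrC; congr (_ + _).
by rewrite /power_comb -sumrN; apply: eq_bigr => i _; rewrite mxE scaleNr.
Qed.

Lemma fails_SLP_unstable :
  fails_SLP J 2 (d%:Z - 2) <-> unstable (derivation_bundle z).
Proof.
have [n [F [F0 hF framesP]]] := exists_generic_frames z_neq0 z_distinct.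
have X0 : ('X_0 : {mpoly C[3]}) != 0 by rewrite -msupp_eq0 msuppX.
split=> [fails|[n' [G [G0 hG split]]]].
  exists n, F; split=> // c c0 Fc.
  have [a [b [e [A [B [frame za t_inj]]]]]] := framesP c Fc.
  have [n0 [w [v [n0d w0 wv]]]] :=
    exists_primitive_basis (fun i => dot (z i) e) za t_inj.
  have [ninj _] := fails (dual_form c) (lform_homog c).
  have [d2 [x [x0 [g [hg xE]]]]] := not_injective_square c0 ninj.
  have d_gt0 : (0 < d)%N by apply: ltnW.
  have det0 : \det (power_mx z a b e) = 0.
    apply/(power_mx_singular z d_gt0 frame); exists x; split=> //; exists g; split=> // ?; lia.
  have /(power_mx_lattice d_gt0 b e za) [y y0 hy] := det0.
  have le_n0 : (n0 <= d)%N.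
    rewrite leqNgt; apply: contra y0 => lt; have [_ w_min _ _] := wv.
    by rewrite (w_min _ _ lt hy).
  (* The difference of the twists is 2(d + 1 - n0), at least 2 because n0 <= d. *)
  exists (1 - n0%:Z), (n0%:Z - (d.+1 + d)%:Z); split; last by clear -le_n0; lia.
  exact: (splits_primitive_basis frame za t_inj n0d w0 wv).
have sing (c : 'rV[C]_3) : c != 0 -> (F * G).@[fun k => c 0 k] != 0 ->
    (0 < d)%N /\ exists x, x != 0 /\ exists g, [/\ power_comb z x = lform c ^+ 2 * g,
      (1 < d)%N -> g \is (d - 2).-homog & d = 1%N -> power_comb z x = 0].
  move=> c0; rewrite mevalM mulf_eq0 negb_or => /andP [Fc Gc].
  have [a [b [e [A [B [frame za t_inj]]]]]] := framesP c Fc.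
  have [n0 [w [v [n0d w0 wv]]]] :=
    exists_primitive_basis (fun i => dot (z i) e) za t_inj.
  have [a' [b' [spl ab]]] := split c c0 Gc.
  have le_n0 := split_degree_bound frame za t_inj n0d w0 wv spl ab.
  have [hw _ _ _] := wv; have n0_gt0 := minimal_gt0 za hw w0.
  have d_gt0 : (0 < d)%N := leq_trans n0_gt0 le_n0.
  split=> //; apply/(power_mx_singular z d_gt0 frame)/(power_mx_lattice d_gt0 b e za).
  exists w => //; case: hw => [hw1 hw2 hw3]; split=> //.
    by apply: leq_trans hw2 _.
  by apply: leq_trans hw3 _.
have [v] : exists v, (F * G * 'X_0).@[v] != 0.
  by apply: exists_meval_neq0; rewrite !mulf_neq0.
pose c0 : 'rV[C]_3 := \row_k v k; rewrite (meval_eq _ (v2 := fun k => c0 0 k)); last first.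
  by move=> k; rewrite mxE.
rewrite mevalM mevalXU mulf_eq0 negb_or => /andP [FGc c00].
have c0_neq0 : c0 != 0 by apply/rV0Pn; exists 0.
have [d_gt0 [x [x0 [g [_ _ d1x]]]]] := sing c0 c0_neq0 FGc.
(* For d = 1 the kernel vector gives a vanishing combination of the linear forms, against
   independence. *)
have d2 : (1 < d)%N.
  rewrite ltn_neqAle d_gt0 andbT eq_sym; apply: contra x0 => /eqP /d1x.
  by move/z_indep => ->.
have generic := power_mx_generic d_gt0 (mulf_neq0 F0 G0) _.
have {}generic : forall c : 'rV[C]_3, c != 0 -> exists a b e A B,
    dual_bases a b e A B c /\ \det (power_mx z a b e) = 0.
  apply: generic => c cn FGc'; have [_ [y [y0 [h [yE _ _]]]]] := sing c cn FGc'.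
  by exists y; split=> //; exists h.
move=> L hL; have LE := homog1_lform hL; set c : 'rV[C]_3 := \row_k _ in LE.
(* [fails_SLP] also ranges over L = 0: the zero map is not injective since R_(d-2) contains a
   nonzero form, nor surjective since the powers do not span R_d. *)
have [c_eq0|cn] := eqVneq c 0.
  have L0 : L = 0 by apply/eqP; rewrite LE lform_eq0 c_eq0.
  split.
    apply: (@mult_square_fails ('X_0 ^+ (d - 2)) 0 L) => //.
    - have := dhomogMn (d - 2) (_ : ('X_0 : {mpoly C[3]}) \is 1.-homog).
      by rewrite mul1n; apply; rewrite dhomogX; apply/eqP/mdeg1.
    - by rewrite expf_neq0.
    by rewrite L0 expr0n mul0r power_comb0.
  have [a [b [e [A [B [frame det0]]]]]] := generic c0 c0_neq0.
  have [h hh hP] := power_mx_not_onto d_gt0 frame det0.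
  apply: (not_surjective_square d2 hL hh) => y g'; rewrite L0 expr0n mul0r.
  by have := hP y 0; rewrite mulr0.
have [a [b [e [A [B [frame det0]]]]]] := generic c cn.
split; last first.
  have [h hh hP] := power_mx_not_onto d_gt0 frame det0.
  by apply: (not_surjective_square d2 hL hh) => y g'; rewrite LE.
have /(power_mx_singular z d_gt0 frame) [y [y0 [g' [yE hg' _]]]] := det0.
apply: (mult_square_fails d2 (hg' d2) (x := y)); last by rewrite LE yE.
apply: contraNneq y0 => g0; apply/eqP/z_indep; by rewrite yE g0 mulr0.
Qed.

End MainProof.

Theorem proposition7p2 (T : realType) (d : nat)
    (l : 'I_(2 * d + 1) -> ring3 T)
    (l_linear : forall i, l i \is 1.-homog)
    (l_neq0 : forall i, l i != 0)
    (l_distinct : forall i j, i != j -> ~ same_line (l i) (l j))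
    (l_indep : forall c : 'I_(2 * d + 1) -> T[i],
      \sum_i c i *: l i ^+ d = 0 -> forall i, c i = 0)
    (I_artinian : artinian_quotient (ideal_gen (fun i => l i ^+ d))) :
  fails_SLP (ideal_gen (fun i => l i ^+ d)) 2 (d%:Z - 2)
  <-> unstable (derivation_bundle (fun i => dual_point (l i))).
Proof.
(* The index type is reshaped to match the two blocks of [power_mx]. *)
have E : (2 * d + 1 = d.+1 + d)%N by lia.
move: l l_linear l_neq0 l_distinct l_indep {I_artinian}; rewrite E => l hl l0 ld li.
pose z i := dual_point (l i).
have lE i : l i = dual_form (z i) by apply: homog1_lform.
have -> : (fun i => l i ^+ d) = (fun i => dual_form (z i) ^+ d).
  by apply: funext => i; rewrite -lE.
apply: fails_SLP_unstable.
- by move=> i; rewrite -lform_eq0 -[lform _]lE.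
- move=> i j ij; apply/negP => /eqP h; apply: (ld i j ij) => u.
  pose v : 'rV_3 := \row_k u k.
  have ev k : (l k).@[u] = dot (z k) v.
    by rewrite lE -meval_lform; apply: meval_eq => k'; rewrite mxE.
  have zn k : z k != 0 by rewrite -lform_eq0 -[lform _]lE.
  have h' : cross (z j) (z i) = 0 by rewrite crossC h oppr0.
  rewrite (ev i) (ev j); split=> E0; first exact: (cross_eq0_dot h (zn i) E0).
  exact: (cross_eq0_dot h' (zn j) E0).
move=> x x0; apply/colP => i; rewrite mxE; apply: (li (fun i => x i 0)).
by rewrite -[RHS]x0; apply: eq_bigr => j _; rewrite lE.
Qed.
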